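(* Let $n\ge1$, let $\chi_{U^-}=(U^-,\gamma_{U^-},\{e_i\}_{i\in I})$ be the geometric crystal on the lower unitriangular group $U^-\subset SL_{n+1}(\mathbb{C})$, with positive structure $\hat\theta:T_0=(\mathbb{C}^\times)^{n(n+1)/2}\to U^-$, and let $B^\sharp=(B^\sharp,wt,\{\tilde e_i\}_{i\in I})$ be the free crystal of generalized Young tableaux. Then $$\mathcal{UD}_{\hat\theta,T_0}(\chi_{U^-})=(B^\sharp,wt,\{\tilde e_i\}_{i\in I}),$$ i.e. $\chi_{U^-}$ is a tropicalization of $B^\sharp$. Explicitly: identify $X_*(T_0)=\mathbb{Z}^{n(n+1)/2}$ with $B^\sharp$ by letting the exponent of the coordinate $A_{k,j}$ ($1\le k\le j\le n$) correspond to $B_{k,j+1}$, and identify $\alpha_i^\vee\in X_*(T)$ with the simple root $\alpha_i$. Then for every $i\in I$ the ultra-discretization $\mathbb{Z}\times X_*(T_0)\to X_*(T_0)$ of $(c,t)\mapsto\hat\theta^{-1}\circ e_i^c\circ\hat\theta(t)$ is $(\beta,v)\mapsto\tilde e_i^{\,\beta}(v)$ (with $\tilde e_i^{-1}=\tilde f_i$), and the ultra-discretization $X_*(T_0)\to X_*(T)$ of $\gamma_{U^-}\circ\hat\theta$ is $wt$.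
   Context: Setting. $I=\{1,\dots,n\}$. $U$ (resp. $U^-$) is the group of upper (resp. lower) unitriangular matrices in $SL_{n+1}(\mathbb{C})$, $T$ the diagonal torus; $x_i(a)=1+aE_{i,i+1}$, $y_i(a)=1+aE_{i+1,i}$, and $\alpha_i^\vee(c)\in T$ has entries $c$, $c^{-1}$ in positions $i$, $i+1$ and $1$ elsewhere; $\{\alpha_i^\vee\}$ is a basis of the cocharacter lattice $X_*(T)$. For $g=g^-g^0g^+\in U^-TU$ put $\pi^{--}(g)=g^-$. The geometric crystal $\chi_{U^-}$: $e_i^c(u)=\pi^{--}\big(x_i(\tfrac{c-1}{\varphi_i(u)})u\big)$, where $\varphi_i:U^-\to(\mathbb{C},+)$ is the homomorphism with $\varphi_i(y_j(t))=\delta_{ij}t$; and $\gamma_{U^-}(u)=\prod_{i\in I}\alpha_i^\vee(f_i(u)^{-1})$, where $f_i(u)$ is the coefficient of $u_{n-i+2}\wedge\cdots\wedge u_{n+1}$ in $u\cdot(u_1\wedge\cdots\wedge u_i)\in\bigwedge^i\mathbb{C}^{n+1}$, $u_1,\dots,u_{n+1}$ being the standard basis. The map $\hat\theta$: for $A=(A_{k,j})_{1\le k\le j\le n}\in T_0$, put $a_{k,j}=\dfrac{A_{k,j}A_{k-1,j}\cdots A_{1,j}}{A_{k-1,j-1}A_{k-2,j-1}\cdots A_{1,j-1}}$ and $\hat\theta(A)=\big(y_n(a_{1,n})y_{n-1}(a_{1,n-1})\cdots y_1(a_{1,1})\big)\big(y_n(a_{2,n})\cdots y_2(a_{2,2})\big)\cdots\big(y_n(a_{n,n})\big)$;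 this is a birational isomorphism $T_0\to U^-$. Ultra-discretization: for $f(c)\in\mathbb{C}(c)\setminus\{0\}$ let $v(f)=\deg f$ (degree of numerator minus degree of denominator). For a positive rational morphism $f=(f_1,\dots,f_q):(\mathbb{C}^\times)^p\to(\mathbb{C}^\times)^q$ (each $f_j$ restricted to any cocharacter is a ratio of polynomials with positive coefficients), its ultra-discretization is the map $\hat f:\mathbb{Z}^p\to\mathbb{Z}^q$, $\hat f(l_1,\dots,l_p)=\big(v(f_j(c^{l_1},\dots,c^{l_p}))\big)_j$. A positive structure on a geometric crystal $(X,\gamma,\{e_i\})$ is a birational isomorphism $\theta:T'\to X$ from an algebraic torus such that $\gamma\circ\theta$ and $e_{i,\theta}:(c,t)\mapsto\theta^{-1}\circ e_i^c\circ\theta(t)$ are positive; $\mathcal{UD}_{\theta,T'}(X,\gamma,\{e_i\})$ is the triplet consisting of $X_*(T')$ and the ultra-discretizations of $\gamma\circ\theta$ and of the $e_{i,\theta}$. If it is isomorphic to a crystal $B$, then $(X,\gamma,\{e_i\})$ is called a tropicalization of $B$. The crystal $B^\sharp$: $B^\sharp=\{(B_{k,j})_{1\le k<j\le n+1}: B_{k,j}\in\mathbb{Z}\}$. For $v=(B_{k,j})$ and $1\le k\le i$ put $b^{(i)}_k(v)=\sum_{1\le l\le k}B_{l,i+1}-\sum_{1\le l\le k-1}B_{l,i}$, $\varepsilon_i(v)=\max_{1\le k\le i}b^{(i)}_k(v)$, $wt(v)=-\sum_{i=1}^n\big(\sum_{1\le k\le i,\ i+1\le j\le n+1}B_{k,j}\big)\alpha_i$,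 and let $m_i$ (resp. $M_i$) be the smallest (resp. largest) $k\in\{1,\dots,i\}$ with $b^{(i)}_k(v)=\varepsilon_i(v)$. $\tilde e_i$ replaces $B_{m_i,i}$ by $B_{m_i,i}+1$ and $B_{m_i,i+1}$ by $B_{m_i,i+1}-1$; $\tilde f_i$ replaces $B_{M_i,i}$ by $B_{M_i,i}-1$ and $B_{M_i,i+1}$ by $B_{M_i,i+1}+1$; all other entries are unchanged, and the change of $B_{i,i}$ (when $m_i=i$ or $M_i=i$) is ignored since $B_{i,i}$ is not a coordinate. *)

(* Defs.v *)
From HB Require Import structures.
From mathcomp Require Import all_boot all_order all_algebra all_fingroup.
From mathcomp Require Import generic_quotient fraction boolp classical_sets reals complex.
From mathcomp Require Import mpoly.

Set Implicit Arguments.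
Unset Strict Implicit.
Unset Printing Implicit Defensive.

Import Order.TTheory GRing.Theory Num.Theory.

Local Open Scope ring_scope.

(* All indices are shifted down by one: i in {1..n} becomes i : 'I_n, and     *)
(* rows and columns of (n+1) x (n+1) matrices are indexed by 'I_n.+1.  The    *)
(* ground field C is R[i] for R : realType.                                   *)

(* Index set of the coordinates A_{k,j}, k <= j, of T_0. *)
Definition tabA (n : nat) := {p : 'I_n * 'I_n | (p.1 <= p.2)%N}.
(* Index set of the coordinates B_{k,j}, k < j, of B^sharp. *)
Definition tabB (n : nat) := {p : 'I_n.+1 * 'I_n.+1 | (p.1 < p.2)%N}.
(* Index set of the matrix entries u_{a,b}, b < a, which are global           *)
(* coordinates on the lower unitriangular group U^-.                          *)
Definition low (n : nat) := {p : 'I_n.+1 * 'I_n.+1 | (p.2 < p.1)%N}.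

Definition rowA n (p : tabA n) : nat := (val p).1.
Definition colA n (p : tabA n) : nat := (val p).2.
Definition rowB n (p : tabB n) : nat := (val p).1.
Definition colB n (p : tabB n) : nat := (val p).2.

Lemma tabB_of_tabA_subproof n (p : tabA n) :
  (widen_ord (leqnSn n) (val p).1 < lift ord0 (val p).2)%N.
Proof. by rewrite lift0 ltnS; exact: (valP p). Qed.

(* (k, j) |-> (k, j + 1) *)
Definition tabB_of_tabA n (p : tabA n) : tabB n :=
  exist _ (widen_ord (leqnSn n) (val p).1, lift ord0 (val p).2)
        (tabB_of_tabA_subproof p).

Section UnitriangularGroup.
Variables (K : fieldType) (n : nat).
Implicit Types (g u : 'M[K]_n.+1) (i : 'I_n) (a c : K).

(* Positions i and i + 1. *)
Definition pos0 i : 'I_n.+1 := widen_ord (leqnSn n) i.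
Definition pos1 i : 'I_n.+1 := lift ord0 i.

Definition x_ i a : 'M[K]_n.+1 := 1 + a *: delta_mx (pos0 i) (pos1 i).
Definition y_ i a : 'M[K]_n.+1 := 1 + a *: delta_mx (pos1 i) (pos0 i).
Definition coroot i c : 'M[K]_n.+1 :=
  diag_mx (\row_j (if j == pos0 i then c else if j == pos1 i then c^-1 else 1)).

Definition in_Uminus g : Prop :=
  forall r s : 'I_n.+1, (r <= s)%N -> g r s = (r == s)%:R.
Definition in_Uplus g : Prop := in_Uminus g^T.
Definition in_T g : Prop := is_diag_mx g /\ \det g = 1.

Definition mx_of_low (x : low n -> K) : 'M[K]_n.+1 :=
  \matrix_(r, s) (if insub (r, s) is Some p then x p else (r == s)%:R).
Definition low_of_mx g : low n -> K := fun p => g (val p).1 (val p).2.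

(* pi^{--}; the value 1 outside U^- T U is a dummy. *)
Definition pi_mm g : 'M[K]_n.+1 :=
  xget 1 [set l : 'M[K]_n.+1 | in_Uminus l /\
    exists d r : 'M[K]_n.+1, [/\ in_T d, in_Uplus r & g = l * d * r]]%classic.

(* See [phiM] and [phi_y] below. *)
Definition phi i u : K := u (pos1 i) (pos0 i).

Definition e_ i c u : 'M[K]_n.+1 := pi_mm (x_ i ((c - 1) / phi i u) * u).

(* Coefficient of e_(r 0) /\ ... /\ e_(r (k-1)) in v 0 /\ ... /\ v (k-1), for *)
(* r strictly increasing.                                                     *)
Definition wedge_coef (m k : nat) (v : 'I_k -> 'cV[K]_m) (r : 'I_k -> 'I_m) : K :=
  \sum_(s : 'S_k) (-1) ^+ s * \prod_(b < k) v b (r (s b)) 0.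

(* With i shifted, u_1 /\ ... /\ u_i has i.+1 factors, and the last i.+1      *)
(* basis vectors have (shifted) indices n - i, ..., n.                        *)
Definition f_ i u : K :=
  wedge_coef (fun b : 'I_i.+1 => u *m delta_mx (inord b) 0)
             (fun b : 'I_i.+1 => inord (n - i + b)).

Definition gamma_Uminus u : 'M[K]_n.+1 := \prod_(i < n) coroot i (f_ i u)^-1.

(* i-th coordinate on T with respect to the basis of simple coroots, i.e. the *)
(* i-th fundamental weight; see [fund_weight_coroots] below.                  *)
Definition fund_weight i (t : 'M[K]_n.+1) : K :=
  \prod_(j < n.+1 | (j <= i)%N) t j j.

Definition a_ (A : tabA n -> K) (k j : 'I_n) : K :=
  (\prod_(p : tabA n | (colA p == j) && (rowA p <= k)%N) A p) /
  (\prod_(p : tabA n | ((colA p).+1 == j) && (rowA p < k)%N) A p).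

(* The inner product is taken over decreasing j. *)
Definition theta_mx (A : tabA n -> K) : 'M[K]_n.+1 :=
  \prod_(k < n) \prod_(j <- rev (enum 'I_n) | (k <= j)%N) y_ j (a_ A k j).

Lemma mx_of_lowK : cancel mx_of_low low_of_mx.
Proof.
move=> x; apply/funext => p.
by rewrite /low_of_mx mxE -surjective_pairing valK.
Qed.

Lemma low_of_mxK u : in_Uminus u -> mx_of_low (low_of_mx u) = u.
Proof.
move=> Uu; apply/matrixP => r s; rewrite mxE; case: insubP => [p _ pE|/=].
  by rewrite /low_of_mx pE.
by rewrite -leqNgt => /Uu.
Qed.

Lemma phi_y i j a : phi i (y_ j a) = (i == j)%:R * a.
Proof.
rewrite /phi !mxE /pos0 /pos1 -!val_eqE /= /bump leq0n add1n eqSS.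
by rewrite (gtn_eqF (ltnSn i)) add0r andbb; apply: mulrC.
Qed.

Lemma phiM i u v :
  in_Uminus u -> in_Uminus v -> phi i (u * v) = phi i u + phi i v.
Proof.
move=> Uu Uv; rewrite /phi mxE (bigD1 (pos0 i)) //= (bigD1 (pos1 i)) /=; last first.
  by rewrite -val_eqE /= /bump leq0n add1n (gtn_eqF (ltnSn i)).
rewrite (Uv (pos0 i) (pos0 i)) // (Uu (pos1 i) (pos1 i)) // !eqxx mulr1 mul1r.
rewrite big1 ?addr0 // => j /andP[j0 j1].
have [ltij|leji] := leqP (pos1 i) j.
  by rewrite Uu // eq_sym (negPf j1) mul0r.
by rewrite (Uv j) // (negPf j0) mulr0.
Qed.

Lemma wedge_coefE m k (v : 'I_k -> 'cV[K]_m) (r : 'I_k -> 'I_m) :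
  wedge_coef v r = \det (\matrix_(b, a) v b (r a) 0).
Proof.
by apply: eq_bigr => s _; congr (_ * _); apply: eq_bigr => b _; rewrite mxE.
Qed.

Lemma fund_weight_coroots i (c : 'I_n -> K) :
  (forall j, c j != 0) -> fund_weight i (\prod_(j < n) coroot j (c j)) = c i.
Proof.
move=> cn0.
have diagE : forall s : seq 'I_n, \prod_(j <- s) coroot j (c j) =
    diag_mx (\row_r \prod_(j <- s) (if r == pos0 j then c j else
      if r == pos1 j then (c j)^-1 else 1)).
  elim=> [|j s IH].
    by rewrite big_nil; apply/matrixP => r t; rewrite !mxE big_nil.
  rewrite big_cons IH -mulmxE mulmx_diag; congr diag_mx.
  by apply/rowP => r; rewrite !mxE big_cons.
rewrite /fund_weight diagE.
under eq_bigr => r _ do rewrite !mxE eqxx mulr1n.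
rewrite exchange_big (bigD1 i) //=; set Q := \prod_(j < n | _) _.
have -> : Q = 1.
  rewrite /Q big1 // => j jni; have [ltji|leij] := ltnP j i.
    rewrite (bigD1 (pos0 j)) /=; last exact: ltnW.
    rewrite (bigD1 (pos1 j)) /=; last first.
      by rewrite -!val_eqE /= /bump leq0n add1n (gtn_eqF (ltnSn j)) ltji.
    rewrite !eqxx -val_eqE /= /bump leq0n add1n (gtn_eqF (ltnSn j)).
    rewrite big1 ?mulr1 ?divff // => r /andP[/andP[_ r0] r1].
    by rewrite (negPf r0) (negPf r1).
  have ltij : (i < j)%N by rewrite ltn_neqAle leij andbT eq_sym.
  rewrite big1 // => r ri.
  rewrite -!val_eqE /= /bump leq0n add1n (ltn_eqF (leq_ltn_trans ri ltij)).
  by rewrite (ltn_eqF (leqW (leq_ltn_trans ri ltij))).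
rewrite mulr1 (bigD1 (pos0 i)) //= eqxx big1 ?mulr1 // => r /andP[ri r0].
by rewrite (negPf r0) -val_eqE /= /bump leq0n add1n (ltn_eqF (_ : r < i.+1)%N).
Qed.

End UnitriangularGroup.

Section RationalMaps.
Variable R : realType.
Local Notation C := R[i].

(* The field C(x_p, p in I). *)
Definition ratfun (I : finType) : fieldType := {fraction {mpoly C[#|I|]}}.
(* The field C(c). *)
Definition ratfun1 : fieldType := {fraction {poly C}}.

Definition ratfunC (I : finType) : C -> ratfun I :=
  @tofrac {mpoly C[#|I|]} \o @mpolyC #|I| C.
HB.instance Definition _ (I : finType) := GRing.RMorphism.copy (@ratfunC I)
  (@tofrac {mpoly C[#|I|]} \o @mpolyC #|I| C).

Definition ratfun1C : C -> ratfun1 := @tofrac {poly C} \o @polyC C.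
HB.instance Definition _ := GRing.RMorphism.copy ratfun1C
  (@tofrac {poly C} \o @polyC C).

(* Value at x of a rational function f, at points x with coordinates in an    *)
(* extension K of C (embedded by iota).                                       *)
Definition mpoly_at (I : finType) (K : fieldType) (iota : C -> K) (x : I -> K)
    (P : {mpoly C[#|I|]}) : K :=
  mmap iota (fun k => x (enum_val k)) P.

Definition has_value (I : finType) (K : fieldType) (iota : C -> K) (x : I -> K)
    (f : ratfun I) (y : K) : Prop :=
  exists P Q : {mpoly C[#|I|]},
    [/\ mpoly_at iota x Q != 0, f = tofrac P / tofrac Q
      & y = mpoly_at iota x P / mpoly_at iota x Q].

(* 0 if f is not defined at x. *)
Definition value (I : finType) (K : fieldType) (iota : C -> K) (x : I -> K)
    (f : ratfun I) : K :=
  xget 0 [set y | has_value iota x f y]%classic.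

(* Rational maps from the space with coordinates I to the one with            *)
(* coordinates J.  They are the points of the latter over [ratfun I], and     *)
(* formulas defining a rational map are evaluated at the generic point        *)
(* [ratid I].                                                                 *)
Definition ratmap (I J : finType) := J -> ratfun I.

Definition ratid (I : finType) : ratmap I I := fun p => tofrac 'X_(enum_rank p).

Definition ratcomp (I J L : finType) (g : ratmap J L) (f : ratmap I J) :
    ratmap I L :=
  fun q => value (@ratfunC I) f (g q).

Definition is_ratinverse (I J : finType) (f : ratmap I J) (g : ratmap J I) : Prop :=
  (forall p, has_value (@ratfunC I) f (g p) (ratid p)) /\
  (forall q, has_value (@ratfunC J) g (f q) (ratid q)).

Definition birational (I J : finType) (f : ratmap I J) : Prop :=
  exists g, is_ratinverse f g.

Definition ratinv (I J : finType) (f : ratmap I J) : ratmap J I :=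
  xget (fun=> 0) [set g | is_ratinverse f g]%classic.

(* id x f, the first factor being the coordinate None. *)
Definition ratpar (I J : finType) (f : ratmap I J) :
    ratmap (option I) (option J) :=
  fun q => if q is Some q' then
             value (@ratfunC (option I)) (fun p => ratid (Some p)) (f q')
           else ratid None.

(* The cocharacter c |-> (c ^ l p)_p of the torus with coordinates I. *)
Definition cocharacter (I : finType) (l : {ffun I -> int}) : I -> ratfun1 :=
  fun p => tofrac 'X ^ l p.

Definition positive_poly (p : {poly C}) : Prop :=
  p != 0 /\ p \is a polyOver Num.nneg.

Definition positive_ratfun1 (g : ratfun1) : Prop :=
  exists p q : {poly C},
    [/\ positive_poly p, positive_poly q & g = tofrac p / tofrac q].

Definition positive_map (I J : finType) (f : ratmap I J) : Prop :=
  forall (q : J) (l : {ffun I -> int}), exists2 g : ratfun1,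
    has_value ratfun1C (cocharacter l) (f q) g & positive_ratfun1 g.

(* Degree of the numerator minus degree of the denominator, for g != 0. *)
Definition vdeg (g : ratfun1) : int :=
  (size (\n_(generic_quotient.repr (g : {fraction {poly C}}))))%:Z - (size (\d_(generic_quotient.repr (g : {fraction {poly C}}))))%:Z.

Definition ultradisc (I J : finType) (f : ratmap I J) (l : {ffun I -> int}) :
    {ffun J -> int} :=
  [ffun q => vdeg (value ratfun1C (cocharacter l) (f q))].

(* The data (gamma, {e_i}) of a geometric crystal on the space with           *)
(* coordinates J; the torus T has the coordinates given by the basis of       *)
(* simple coroots, and the parameter c of e_i is the coordinate None.         *)
Record crystal_data (n : nat) (J : finType) := CrystalData {
  gc_gamma : ratmap J 'I_n;
  gc_e : 'I_n -> ratmap (option J) J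
}.

Section PositiveStructure.
Variables (n : nat) (I J : finType).
Variables (chi : crystal_data n J) (theta : ratmap I J).

Definition gamma_theta : ratmap I 'I_n := ratcomp (gc_gamma chi) theta.
Definition e_theta (i : 'I_n) : ratmap (option I) I :=
  ratcomp (ratinv theta) (ratcomp (gc_e chi i) (ratpar theta)).

Definition positive_structure : Prop :=
  [/\ birational theta, positive_map gamma_theta
    & forall i, positive_map (e_theta i)].

Definition UD_gamma (l : {ffun I -> int}) : {ffun 'I_n -> int} :=
  ultradisc gamma_theta l.
Definition UD_e (i : 'I_n) (b : int) (l : {ffun I -> int}) : {ffun I -> int} :=
  ultradisc (e_theta i) [ffun o => if o is Some p then l p else b].
End PositiveStructure.

Definition chi_Uminus (n : nat) : crystal_data n (low n) :=
  CrystalData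
    (fun i => fund_weight i (gamma_Uminus (mx_of_low (@ratid (low n)))))
    (fun i => low_of_mx
       (e_ i (ratid None) (mx_of_low (fun q : low n => ratid (Some q))))).

Definition theta_hat (n : nat) : ratmap (tabA n) (low n) :=
  low_of_mx (theta_mx (@ratid (tabA n))).

End RationalMaps.

Arguments chi_Uminus R n : clear implicits.
Arguments theta_hat R n _ : clear implicits.

Section Bsharp.
Variable n : nat.

Definition Bsharp := {ffun tabB n -> int}.
Implicit Types (v : Bsharp) (i : 'I_n).

Definition b_ i v (k : nat) : int :=
  \sum_(p : tabB n | (colB p == i.+1) && (rowB p <= k)%N) v p -
  \sum_(p : tabB n | (colB p == i :> nat) && (rowB p < k)%N) v p.

Definition epsilon_ i v : int :=
  \big[Num.max/b_ i v 0]_(k < i.+1) b_ i v k.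

(* Coefficients of the weight on the simple roots. *)
Definition wt v : {ffun 'I_n -> int} :=
  [ffun i : 'I_n => - \sum_(p : tabB n | (rowB p <= i)%N && (i < colB p)%N) v p].

Definition m_ i v : 'I_i.+1 :=
  [arg min_(k < (ord0 : 'I_i.+1) | b_ i v k == epsilon_ i v) (k : nat)]%N.
Definition M_ i v : 'I_i.+1 :=
  [arg max_(k > (ord0 : 'I_i.+1) | b_ i v k == epsilon_ i v) (k : nat)]%N.

(* v + d at position (m, i), v - d at position (m, i + 1); there is no        *)
(* position (i, i) in tabB.                                                   *)
Definition shift_tab i (m : nat) (d : int) v : Bsharp :=
  [ffun p : tabB n =>
     if (rowB p == m) && (colB p == i :> nat) then v p + d
     else if (rowB p == m) && (colB p == i.+1) then v p - d
     else v p].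

Definition etilde i v : Bsharp := shift_tab i (m_ i v) 1 v.
Definition ftilde i v : Bsharp := shift_tab i (M_ i v) (-1) v.

Definition etilde_pow i (b : int) v : Bsharp :=
  match b with
  | Posz k => iter k (etilde i) v
  | Negz k => iter k.+1 (ftilde i) v
  end.

(* The exponent of A_{k,j} is B_{k,j+1}. *)
Definition cochar_of_tableau v : {ffun tabA n -> int} :=
  [ffun p : tabA n => v (tabB_of_tabA p)].

End Bsharp.

(* Main.v *)
Require Import Defs.
From mathcomp Require Import all_boot all_order all_algebra reals.
From mathcomp Require Import all_fingroup generic_quotient fraction boolp.
From mathcomp Require Import classical_sets complex mpoly zify ring.

(* Each block y_n(a_{k,n}) ... y_k(a_{k,k}) has a bidiagonal inverse, so the  *)
(* minors of theta(A) on the first columns and consecutive rows are monomials *)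
(* in A; these minors determine a unitriangular matrix when they do not       *)
(* vanish, which gives theta^-1 and, for the lower left ones, gamma.          *)
(* Pushing x_i through theta(A), one block at a time, shows that e_i^c        *)
(* multiplies A_{k,i} by N_k / N_{k+1} and A_{k,i-1} by N_{k+1} / N_k, where  *)
(* N_k = c (a_{0,i} + ... + a_{k-1,i}) + a_{k,i} + ... + a_{i,i}.             *)
(* The N_k are subtraction-free, so the maps are positive and the degree      *)
(* turns their sums into maxima.  Raising the exponent of c by one raises the *)
(* degree of N_k exactly for the k beyond the first maximum of the shifted    *)
(* b_k, which is the rule defining the crystal operator.                      *)
(* Rational maps are compared by specialization: taking the value at a point  *)
(* is a partial homomorphism (a place) from the function field, so every      *)
(* identity between generic formulas is transported along it.                 *)

Set Implicit Arguments.
Unset Strict Implicit.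
Unset Printing Implicit Defensive.

Import Order.TTheory GRing.Theory Num.Theory.

Local Open Scope ring_scope.

(** Let C_{k,j} be the product of the first k entries of column j of A. Each a_{k,j} is a quotient
    of two such products, and along the diagonals of the factorization these quotients telescope.
    Hence the minors of theta(A) on the first columns and consecutive rows are products of C's
    ([minor_theta]), their ratios recover A ([theta_mxK], [theta_invK]), and f_i is the product of
    the A_{k,j} with k <= i <= j ([f_theta]). Taking the degree of its inverse gives wt.

    For e_i, an upper triangular element of the i-th SL_2 is moved to the right across the factors
    y_j ([Xmx_urow], [x_theta]). What comes out on the right lies in TU and is discarded by the
    projection, so e_i^c theta(A) = theta([act c i A]). This formula is subtraction-free, hence its
    ultra-discretization is [tact], with sums replaced by maxima ([posdeg_act], [UD_eE]).

    It remains to identify [tact b i] with the b-th power of the crystal operator, by induction on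
    |b| from a fixed starting point ([etilde_powE]). The numbers b_k of the tableau reached at
    exponent d are the degrees of the transformed a_{k,i} ([tan_tact]). When d >= 0 grows by one,
    the tropical N_k grows by one exactly for k beyond the first maximizer m of these numbers
    ([raise_offset]). So the differences N_k - N_{k+1} change only at k = m, as the raising operator
    prescribes. [lower_offset] is the mirror statement for the lowering operator and the last
    maximizer. *)

Section Unitriangular.
Variables (K : fieldType) (n : nat).
Implicit Types (u w g : 'M[K]_n.+1) (i j : 'I_n) (b : nat -> nat -> K).

Lemma in_Uminus1 : in_Uminus (1 : 'M[K]_n.+1).
Proof. by move=> r s _; rewrite mxE. Qed.

Lemma in_UminusM u w : in_Uminus u -> in_Uminus w -> in_Uminus (u * w).
Proof.
move=> Uu Uw r s rs; rewrite mxE (bigD1 r) //= Uu // eqxx mul1r Uw //.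
rewrite big1 ?addr0 // => t tr; have [rt|tr'] := leqP r t.
  by rewrite Uu // eq_sym (negPf tr) mul0r.
have ts : (t < s)%N by apply: leq_trans rs.
by rewrite Uw 1?ltnW // -val_eqE (ltn_eqF ts) mulr0.
Qed.

Lemma y_E j (c : K) r s :
  y_ j c r s = (r == s)%:R + c * ((r == j.+1 :> nat) && (s == j :> nat))%:R.
Proof. by rewrite !mxE -!val_eqE /= /bump leq0n add1n. Qed.

Lemma in_Uminus_y j (c : K) : in_Uminus (y_ j c).
Proof.
move=> r s rs; rewrite y_E; case: andP => [[/eqP r1 /eqP s0]|_]; last first.
  by rewrite mulr0 addr0.
by move: rs; rewrite r1 s0 ltnn.
Qed.

Lemma in_Uminus_prod (I : Type) (l : seq I) (P : pred I) (F : I -> 'M[K]_n.+1) :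
  (forall x, P x -> in_Uminus (F x)) -> in_Uminus (\prod_(x <- l | P x) F x).
Proof.
move=> H; apply: (big_ind (@in_Uminus K n)) => //; first exact: in_Uminus1.
exact: in_UminusM.
Qed.

(** * Tail products of the factorization and their minors *)

Definition urow b k : 'M[K]_n.+1 :=
  \prod_(j <- rev (enum 'I_n) | (k <= j)%N) y_ j (b k j).
Definition utail b m : 'M[K]_n.+1 := \prod_(m <= k < n) urow b k.

Lemma in_Uminus_urow b k : in_Uminus (urow b k).
Proof. by apply: in_Uminus_prod => j _; apply: in_Uminus_y. Qed.

Lemma in_Uminus_utail b m : in_Uminus (utail b m).
Proof. by apply: in_Uminus_prod => k _; apply: in_Uminus_urow. Qed.

(** Carries [T] from left to right through a product in decreasing order. It serves both for
    inverting a block and for pushing x_i through it. *)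
Lemma prod_rev_ord_tele (T : nat -> 'M[K]_n.+1) m (F F' : 'I_m -> 'M[K]_n.+1) :
  (forall j : 'I_m, T j.+1 * F j = F' j * T j) ->
  T m * \prod_(j <- rev (enum 'I_m)) F j =
  \prod_(j <- rev (enum 'I_m)) F' j * T 0.
Proof.
elim: m F F' => [|m IH] F F' H.
  rewrite (_ : enum 'I_0 = [::]) ?big_nil ?mul1r ?mulr1 //.
  by apply: size0nil; rewrite size_enum_ord.
rewrite enum_ordSr rev_rcons !big_cons mulrA (H ord_max) -!mulrA; congr (_ * _).
by rewrite -map_rev !big_map; apply: IH => j; apply: (H (widen_ord _ j)).
Qed.

Lemma prod_ord_tele (T : nat -> 'M[K]_n.+1) m (F F' : nat -> 'M[K]_n.+1) :
  (forall k, (k < m)%N -> T k * F k = F' k * T k.+1) ->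
  T 0 * \prod_(0 <= k < m) F k = \prod_(0 <= k < m) F' k * T m.
Proof.
elim: m => [|m IH] H; first by rewrite !big_geq // mul1r mulr1.
rewrite !big_nat_recr //= mulrA IH; last by move=> k km; apply: H; apply: leqW.
by rewrite -!mulrA H.
Qed.

Definition bidiag b m (t : nat) : 'M[K]_n.+1 :=
  1 - \sum_(l < n | (m <= l < t)%N) b m l *: delta_mx (pos1 l) (pos0 l).

(** The inverse of a block is a product of y_l with l increasing, and E_{l+1,l} E_{j+1,j} = 0 for l
    <= j, so its expansion has no terms of higher order. The proof lets [bidiag b m j.+1] absorb the
    factor y_j and become [bidiag b m j]. *)
Lemma bidiag_urow b m : bidiag b m n * urow b m = 1.
Proof.
pose F j := if (m <= j)%N then y_ j (b m j) else (1 : 'M[K]_n.+1).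
have -> : urow b m = \prod_(j <- rev (enum 'I_n)) F j by rewrite /urow big_mkcond.
rewrite (prod_rev_ord_tele (F' := fun=> 1)) => [|j].
  rewrite big1_eq mul1r /bidiag big1 ?subr0 // => l.
  by rewrite ltn0 andbF.
rewrite mul1r /F; case: leqP => mj; last first.
  rewrite mulr1 /bidiag; congr (_ - _); apply: eq_bigl => l; lia.
rewrite {1}/bidiag (bigD1 j) /=; last by rewrite mj ltnSn.
rewrite (eq_bigl (fun l : 'I_n => (m <= l < j)%N)); last by move=> l; rewrite -val_eqE /=; lia.
rewrite opprD [- _ - _]addrC addrA -/(bidiag b m j) mulrBl /y_ mulrDr mulr1.
set d := delta_mx _ _.
have E0 (l : 'I_n) : (l <= j)%N -> delta_mx (pos1 l) (pos0 l) * d = 0 :> 'M[K]_n.+1.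
  move=> lj; rewrite -mulmxE mul_delta_mx_cond.
  by rewrite -val_eqE /= /bump leq0n add1n ltn_eqF ?mulr0n // ltnS.
have -> : bidiag b m j * (b m j *: d) = b m j *: d.
  rewrite /bidiag mulrBl mul1r mulr_suml big1 ?subr0 // => l /andP[_ lj].
  by rewrite -scalerAl -scalerAr E0 ?scaler0 // ltnW.
rewrite mulrDr mulr1 -scalerAl -scalerAr E0 // !scaler0 addr0.
by rewrite addrK.
Qed.

Lemma utailS b m : (m < n)%N -> bidiag b m n * utail b m = utail b m.+1.
Proof. by move=> mn; rewrite /utail big_ltn // mulrA bidiag_urow mul1r. Qed.

Lemma utail_step b m r s : (m < n)%N -> (m <= r < n)%N ->
  utail b m.+1 (inord r.+1) s = utail b m (inord r.+1) s - b m r * utail b m (inord r) s.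
Proof.
move=> mn /andP[mr rn]; rewrite -utailS // /bidiag mulrBl mul1r mulr_suml mxE; congr (_ + _).
rewrite mxE summxE; congr (- _).
pose j := Ordinal rn.
rewrite (bigD1 j) /= ?mr //.
have E (l : 'I_n) : delta_mx (pos1 l) (pos0 l) * utail b m = 
     \matrix_(x, y) ((x == pos1 l)%:R * utail b m (pos0 l) y).
  apply/matrixP => x y; rewrite !mxE (bigD1 (pos0 l)) //= big1 => [|t].
    by rewrite !mxE eqxx andbT addr0.
  by move=> /negPf tl; rewrite !mxE tl andbF mul0r.
rewrite big1 ?addr0 => [|l /andP[_ lj]].
  rewrite -scalerAl E !mxE -val_eqE /= inordK /bump ?add1n ?eqxx ?mul1r //.
  by congr (_ * utail _ _ _ _); apply: val_inj; rewrite /= inordK // ltnW.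
rewrite -scalerAl E !mxE -val_eqE /= inordK /bump ?add1n //.
by rewrite eqSS eq_sym; move/negPf: lj; rewrite -val_eqE /= => ->; rewrite mul0r mulr0.
Qed.

Lemma utail_col b m (r s : 'I_n.+1) : (s < m)%N -> utail b m r s = (r == s)%:R.
Proof.
move=> sm; rewrite /utail.
pose P u := forall r, u r s = (r == s)%:R.
have P1 : P 1 by move=> x; rewrite mxE.
have PM u w : P u -> P w -> P (u * w).
  move=> Pu Pw x; rewrite mxE (bigD1 s) //= Pw eqxx mulr1 Pu big1 ?addr0 //.
  by move=> t /negPf ts; rewrite Pw ts mulr0.
suff : P (\prod_(m <= k < n) urow b k) by apply.
rewrite big_nat_cond; apply: (big_ind P) => // k; rewrite andbT => /andP[mk _].
apply: (big_ind P) => // j kj x; rewrite y_E.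
by rewrite (ltn_eqF (leq_trans sm (leq_trans mk kj))) andbF mulr0 addr0.
Qed.

(** Column m of the next tail vanishes below the diagonal, so [utail_step] becomes a recursion down
    column m. *)
Lemma utail_first b m t : (m + t <= n)%N ->
  utail b m (inord (m + t)) (inord m) = \prod_(j < t) b m (m + j).
Proof.
elim: t => [|t IH] H.
  by rewrite addn0 big_ord0 in_Uminus_utail ?eqxx.
have mn : (m < n)%N by lia.
have := utail_step b (r := m + t) (inord m) mn.
rewrite utail_col; last by rewrite inordK; lia.
rewrite big_ord_recr /= -IH ?addnS; last by lia.
have -> : (inord (m + t).+1 == inord m :> 'I_n.+1) = false.
  by rewrite -val_eqE /= !inordK; lia.
move/(_ _)/esym/eqP; rewrite subr_eq0 => /(_ _)/eqP -> //; first by rewrite mulrC.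
lia.
Qed.

Definition minor u m k s : K :=
  \det (\matrix_(x < k, y < k) u (inord (s + x)) (inord (m + y))).

(** Induction on the size: after row operations the first column keeps only its top entry, given by
    [utail_first], and the complementary block is a smaller minor of the next tail. *)
Lemma minor_utail b k m t : (m + t + k <= n.+1)%N -> (0 < k -> m <= n)%N ->
  minor (utail b m) m k (m + t) = \prod_(l < k) \prod_(j < t) b (m + l)%N (m + l + j)%N.
Proof.
elim: k m => [|k IH] m H Hm.
  by rewrite /minor det_mx00 big_ord0.
rewrite big_ord_recl /= addn0.
set v := utail b m.
(* The row operations L clear column m below its first entry and turn the     *)
(* other rows into rows of the next tail product.                             *)
pose L : 'M[K]_k.+1 := \matrix_(x, y) ((x == y)%:R - b m (m + t + y)%N * (x == y.+1 :> nat)%:R).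
pose M : 'M[K]_k.+1 := \matrix_(x, y) v (inord (m + t + x)) (inord (m + y)).
have detL : \det L = 1.
  rewrite det_trig; last first.
    apply/is_trig_mxP => x y xy; rewrite !mxE -val_eqE (ltn_eqF xy).
    by rewrite (ltn_eqF (leqW xy)) mulr0 subr0.
  by rewrite big1 // => x _; rewrite !mxE eqxx (ltn_eqF (ltnSn x)) mulr0 subr0.
have -> : minor v m k.+1 (m + t) = \det (L *m M) by rewrite det_mulmx detL mul1r.
have LM0 y : (L *m M) ord0 y = M ord0 y.
  rewrite mxE (bigD1 ord0) //= big1 => [|x /negPf x0].
    by rewrite !mxE eqxx /= mulr0 subr0 mul1r addr0.
  by rewrite [L _ _]mxE eq_sym x0 /= mulr0 subr0 mul0r.
have LMS (x : 'I_k) y :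
    (L *m M) (lift ord0 x) y = utail b m.+1 (inord (m + t + x).+1) (inord (m + y)).
  have kx := ltn_ord x.
  rewrite utail_step; [|lia|lia].
  pose x' : 'I_k.+1 := widen_ord (leqnSn k) x.
  have nx : x' != lift ord0 x by rewrite -val_eqE /= /bump; lia.
  rewrite mxE (bigD1 (lift ord0 x)) //= (bigD1 x') //= big1 => [|z /andP[z1 z2]].
    rewrite ![L _ _]mxE ![M _ _]mxE eqxx -!val_eqE /= /bump leq0n add1n (ltn_eqF (ltnSn _)).
    rewrite mulr0 subr0 mul1r addnS addr0 (gtn_eqF (ltnSn x)) eqxx mulr1 sub0r mulNr.
    by [].
  rewrite [L _ _]mxE eq_sym (negPf z1) /= /bump leq0n add1n.
  by move: z2; rewrite -val_eqE /= eqSS eq_sym => /negPf ->; rewrite mulr0 subrr mul0r.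
rewrite (expand_det_col _ ord0) big_ord_recl big1 => [|x _]; last first.
  rewrite LMS addn0 utail_col; last by rewrite inordK; lia.
  have kx := ltn_ord x; rewrite -val_eqE /= !inordK; [|lia|lia].
  by rewrite gtn_eqF ?mul0r //; lia.
rewrite addr0 LM0 mxE !addn0 utail_first; last by lia.
congr (_ * _).
rewrite /cofactor /= expr0 mul1r.
under [RHS]eq_bigr => l _ do
  (rewrite /bump leq0n add1n; under eq_bigr => j _ do rewrite addnS -addSn).
rewrite -IH ?addSn; [|lia|lia].
rewrite /minor; congr (\det _); apply/matrixP => x y; rewrite 2!mxE LMS.
by rewrite [RHS]mxE lift0 !addnS !addSn.
Qed.

End Unitriangular.

(** * Monomial minors of theta and the inverse of theta *)

Section Factorization.
Variables (K : fieldType) (n : nat).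
Implicit Types (u w g : 'M[K]_n.+1) (i j : 'I_n) (A : tabA n -> K).

Lemma minor_Uminus0 u k : in_Uminus u -> (k <= n.+1)%N -> minor u 0 k 0 = 1.
Proof.
move=> Uu kn; rewrite /minor det_trig; last first.
  apply/is_trig_mxP => x y xy; have := ltn_ord x; have := ltn_ord y => yk xk.
  rewrite !mxE Uu; last by rewrite /= !inordK; lia.
  by rewrite -val_eqE /= !inordK ?ltn_eqF //; lia.
by rewrite big1 // => x _; rewrite !mxE Uu ?eqxx.
Qed.

Lemma f_minor i u : f_ i u = minor u 0 i.+1 (n - i).
Proof.
rewrite /f_ wedge_coefE /minor -det_tr; congr (\det _); apply/matrixP => x y.
rewrite !mxE (bigD1 (inord y)) //= big1 => [|t /negPf ty]; last first.
  by rewrite !mxE ty mulr0.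
by rewrite addr0 mxE !eqxx mulr1.
Qed.

Lemma minor_cofactor u k s :
  cofactor (\matrix_(x < k.+1, y < k.+1) u (inord (s + x)) (inord (0 + y))) ord_max ord_max
  = minor u 0 k s.
Proof.
rewrite /cofactor addnn -signr_odd odd_double expr0 mul1r; congr (\det _).
apply/matrixP => x y; rewrite !mxE !lift_max; congr (u _ _).
Qed.

(** Entries are recovered column by column, and down each column. In the minor whose bottom right
    corner is the entry sought, all other entries are already known, and the cofactor of that corner
    is a smaller, nonvanishing minor. *)
Lemma minor_inj u w : in_Uminus u -> in_Uminus w ->
  (forall k s, (k + s <= n.+1)%N -> minor u 0 k s != 0) ->
  (forall k s, (k + s <= n.+1)%N -> minor w 0 k s = minor u 0 k s) -> w = u.
Proof.
move=> Uu Uw nz E.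
suff H k : forall s, (k + s < n.+1)%N -> w (inord (s + k)) (inord k) = u (inord (s + k)) (inord k).
  apply/matrixP => r s; have [rs|sr] := leqP r s; first by rewrite Uu // Uw.
  have := H s (r - s)%N; rewrite subnKC ?subnK; try exact: ltnW.
  by rewrite !inord_val; apply.
elim/ltn_ind: k => k IHk; elim/ltn_ind => s IHs ks.
have := E k.+1 s ks.
rewrite /minor !(expand_det_row _ ord_max) (bigD1 ord_max) //= [RHS](bigD1 ord_max) //=.
pose MM (v : 'M[K]_n.+1) := \matrix_(x < k.+1, y < k.+1) v (inord (s + x)) (inord (0 + y)).
have ME (x y : 'I_k.+1) : ~~ ((x == ord_max) && (y == ord_max)) -> MM w x y = MM u x y.
  move=> xy; rewrite !mxE add0n.
  have xk := ltn_ord x; have yk := ltn_ord y; rewrite -!val_eqE /= in xy.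
  have [sxy|sxy] := leqP (s + x) y.
    by rewrite Uu ?Uw //= !inordK; lia.
  have -> : (s + x)%N = ((s + x - y) + y)%N by lia.
  have [yk'|/eqP yk'|] := ltngtP y k; [|lia|].
    by apply: IHk => //; lia.
  by move=> yk''; rewrite yk''; apply: IHs; lia.
rewrite !minor_cofactor !mxE /= E; last lia.
have -> : \sum_(i < k.+1 | i != ord_max) MM w ord_max i * cofactor (MM w) ord_max i =
          \sum_(i < k.+1 | i != ord_max) MM u ord_max i * cofactor (MM u) ord_max i.
  apply: eq_bigr => y /negPf yk; rewrite ME ?yk ?andbF //; congr (_ * (_ * \det _)).
  apply/matrixP => x z; rewrite ![row' _ _ _ _]mxE ![col' _ _ _ _]mxE ME //.
  by rewrite eq_sym (negPf (neq_lift _ _)).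
by move/addIr/mulIf; apply; apply: nz; lia.
Qed.

Definition unip (b : nat -> nat -> K) : 'M[K]_n.+1 := utail n b 0.

Lemma in_Uminus_unip b : in_Uminus (unip b).
Proof. exact: in_Uminus_utail. Qed.

Lemma minor_unip b k s : (k + s <= n.+1)%N ->
  minor (unip b) 0 k s = \prod_(l < k) \prod_(j < s) b l (l + j)%N.
Proof. by move=> ks; rewrite -[s in LHS]add0n minor_utail //; lia. Qed.

(* Entries A_{k,j} with natural indices; 1 outside 0 <= k <= j < n. *)
Definition tab A (k j : nat) : K :=
  \prod_(p : tabA n | (rowA p == k) && (colA p == j)) A p.

Definition colprod A (k j : nat) : K := \prod_(l < k) tab A l j.

(** The truncated predecessor is harmless: for k <= j, the value j = 0 forces k = 0, and the
    denominator is then an empty product. *)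
Definition an A (k j : nat) : K := colprod A k.+1 j / colprod A k j.-1.

Lemma colprod0 A (j : nat) : colprod A 0 j = 1.
Proof. exact: big_ord0. Qed.

Lemma colprodE A k (j : nat) :
  \prod_(p : tabA n | (colA p == j) && (rowA p < k)%N) A p = colprod A k j.
Proof.
rewrite /colprod; elim: k => [|k IH].
  by rewrite big_ord0 big_pred0 // => p; rewrite andbF.
rewrite big_ord_recr /= -IH (bigID (fun p => (rowA p < k)%N)) /=; congr (_ * _).
  by apply: eq_bigl => p; lia.
by apply: eq_bigl => p; lia.
Qed.

Lemma tab_val A p : tab A (rowA p) (colA p) = A p.
Proof. by rewrite /tab (big_pred1 p). Qed.

Lemma a_E A (k j : 'I_n) : (k <= j)%N -> a_ A k j = an A k j.
Proof.
move=> kj; rewrite /a_ /an -!colprodE; congr (_ / _).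
case: (val j) kj => [|m] kj /=; last by apply: eq_bigl => p; rewrite eqSS.
by rewrite !big_pred0 // => p; rewrite ?andbF //; lia.
Qed.

Lemma theta_mxE A : theta_mx A = unip (an A).
Proof.
rewrite /unip /utail big_mkord; apply: eq_bigr => k _.
by apply: eq_bigr => j kj; rewrite a_E.
Qed.

Lemma tab_neq0 A k (j : nat) : (forall p, A p != 0) -> tab A k j != 0.
Proof. by move=> nz; apply/prodf_neq0 => p _. Qed.

Lemma colprod_neq0 A k (j : nat) : (forall p, A p != 0) -> colprod A k j != 0.
Proof. by move=> nz; apply/prodf_neq0 => p _; apply: tab_neq0. Qed.

(** Along a diagonal the numerator of each factor is the denominator of the next. *)
Lemma prod_an A k (j : nat) : (forall p, A p != 0) ->
  \prod_(m < k) an A m (m + j) = colprod A k (k + j).-1.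
Proof.
move=> nz; elim: k => [|k IH]; first by rewrite big_ord0 /colprod big_ord0.
by rewrite big_ord_recr /= IH /an mulrC divfK // colprod_neq0.
Qed.

Lemma minor_theta A k s : (forall p, A p != 0) -> (k + s <= n.+1)%N ->
  minor (theta_mx A) 0 k s = \prod_(j < s) colprod A k (k + j).-1.
Proof.
move=> nz ks; rewrite theta_mxE minor_unip // exchange_big.
by apply: eq_bigr => j _; rewrite prod_an.
Qed.

Lemma minor_theta_neq0 A k s : (forall p, A p != 0) -> (k + s <= n.+1)%N ->
  minor (theta_mx A) 0 k s != 0.
Proof.
by move=> nz ks; rewrite minor_theta //; apply/prodf_neq0 => j _; apply: colprod_neq0.
Qed.

Lemma in_Uminus_theta A : in_Uminus (theta_mx A).
Proof. by rewrite theta_mxE; apply: in_Uminus_unip. Qed.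

Definition minor_ratio u k s : K := minor u 0 k s.+1 / minor u 0 k s.

(** On theta(A) a [minor_ratio] is a column product, and the quotient of two consecutive column
    products isolates one coordinate. *)
Definition theta_inv u (p : tabA n) : K :=
  minor_ratio u (rowA p).+1 (colA p - rowA p) /
  minor_ratio u (rowA p) (colA p - rowA p).+1.

Lemma row_le_col (p : tabA n) : (rowA p <= colA p)%N. Proof. exact: (valP p). Qed.
Lemma col_lt (p : tabA n) : (colA p < n)%N. Proof. exact: ltn_ord. Qed.

Lemma minor_ratio_theta A k s : (forall p, A p != 0) -> (k + s <= n)%N ->
  minor_ratio (theta_mx A) k s = colprod A k (k + s).-1.
Proof.
move=> nz ks; rewrite /minor_ratio !minor_theta //; try lia.
rewrite big_ord_recr /= mulrC mulKf //.
by apply/prodf_neq0 => j _; apply: colprod_neq0.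
Qed.

Lemma theta_mxK A : (forall p, A p != 0) -> theta_inv (theta_mx A) =1 A.
Proof.
move=> nz p; have := row_le_col p; have := col_lt p => cn rc.
rewrite /theta_inv !minor_ratio_theta //; try lia.
rewrite addSn addnS subnKC //= /colprod big_ord_recr /= mulrC mulKf ?tab_val //.
exact: colprod_neq0.
Qed.

(** The open set on which [theta_inv] inverts theta. It contains theta(A) whenever all coordinates
    of A are nonzero. *)
Definition generic u := in_Uminus u /\
  forall k s, (k + s <= n.+1)%N -> minor u 0 k s != 0.

Lemma minor_ratio_neq0 u k s : generic u -> (k + s <= n)%N -> minor_ratio u k s != 0.
Proof. by move=> [_ nz] ks; rewrite mulf_neq0 ?invr_neq0 ?nz //; lia. Qed.

Lemma theta_inv_neq0 u p : generic u -> theta_inv u p != 0.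
Proof.
move=> gu; have := row_le_col p; have := col_lt p => cn rc.
by rewrite mulf_neq0 ?invr_neq0 ?minor_ratio_neq0 //; lia.
Qed.

Lemma colprod_theta_inv u k (j : nat) : generic u -> (k <= j.+1)%N -> (j < n)%N ->
  colprod (theta_inv u) k j = minor_ratio u k (j.+1 - k).
Proof.
move=> gu; elim: k => [|k IH] kj jn.
  by rewrite /colprod big_ord0 /minor_ratio /minor !det_mx00 divr1.
have kn : (k < n)%N by lia.
have kj' : (k <= j)%N by [].
pose p : tabA n := exist _ (Ordinal kn, Ordinal jn) kj'.
rewrite /colprod big_ord_recr /= -/(colprod _ k j) IH; [|lia|lia].
rewrite (tab_val (theta_inv u) p : tab _ k j = _) /theta_inv /rowA /colA /=.
rewrite subSn // subSS mulrC divfK // minor_ratio_neq0 //; lia.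
Qed.

(** By [minor_inj] it suffices to compare minors. Those of the left side are products of column
    products, which are ratios of minors of [u] and telescope. *)
Lemma theta_invK u : generic u -> theta_mx (theta_inv u) = u.
Proof.
move=> gu; have [Uu nz] := gu.
have nz' p : theta_inv u p != 0 by apply: theta_inv_neq0.
apply: minor_inj => // [|k s ks]; first exact: in_Uminus_theta.
rewrite minor_theta //; case: k ks => [|k] ks.
  rewrite /minor det_mx00 big1 // => j _.
  by rewrite /colprod big_ord0.
transitivity (\prod_(t < s) minor_ratio u k.+1 t).
  apply: eq_bigr => t _; have := ltn_ord t => js.
  by rewrite colprod_theta_inv //=; [congr minor_ratio; lia|lia|lia].
elim: s ks => [|s IH] ks; first by rewrite big_ord0 minor_Uminus0 //; lia.
rewrite big_ord_recr /= IH; last by lia.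
by rewrite /minor_ratio mulrC divfK // nz //; lia.
Qed.

Lemma f_theta A i : (forall p, A p != 0) ->
  f_ i (theta_mx A) = \prod_(p : tabA n | (rowA p <= i)%N && (i <= colA p)%N) A p.
Proof.
move=> nz; have := ltn_ord i => ilt; rewrite f_minor minor_theta //; last lia.
transitivity (\prod_(j < n | (i <= j)%N) colprod A i.+1 j).
  rewrite -(big_mkord (fun t : nat => i <= t)%N (fun t => colprod A i.+1 t)).
  rewrite (@big_cat_nat _ _ _ i) //=; last exact: ltnW.
  rewrite [X in _ = X * _]big_nat_cond [X in _ = X * _]big1 ?mul1r; last first.
    by move=> t ?; exfalso; lia.
  rewrite -[X in \prod_(X <= _ < _ | _) _]add0n big_addn big_mkord.
  by apply: eq_big => t; rewrite ?leq_addl // addnC.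
under eq_bigr => j _ do rewrite -colprodE.
rewrite (exchange_big_dep (fun p => (rowA p <= i)%N && (i <= colA p)%N)) /=; last first.
  by move=> j p ij /andP[/eqP -> ?]; rewrite ij andbT.
apply: eq_bigr => p /andP[ri ic].
rewrite (big_pred1 (val p).2) // => j /=.
by rewrite /colA ltnS ri andbT -val_eqE eq_sym /= andbC; case: eqP => //= ->.
Qed.

End Factorization.

(** * The action of e_i in the coordinates A *)

Section Action.
Variables (K : fieldType) (n : nat).
Implicit Types (u w g : 'M[K]_n.+1) (i j : 'I_n) (A : tabA n -> K).

Lemma phi1 i : phi i (1 : 'M[K]_n.+1) = 0.
Proof. by rewrite /phi mxE -val_eqE /= /bump leq0n add1n gtn_eqF. Qed.

Lemma phi_prod i (I : Type) (l : seq I) (P : pred I) (F : I -> 'M[K]_n.+1) :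
  (forall x, P x -> in_Uminus (F x)) ->
  phi i (\prod_(x <- l | P x) F x) = \sum_(x <- l | P x) phi i (F x).
Proof.
move=> H; elim: l => [|x l IH]; first by rewrite !big_nil phi1.
rewrite !big_cons; case: ifP => // Px.
by rewrite phiM ?IH //; [apply: H | apply: in_Uminus_prod].
Qed.

Lemma phi_urow i (b : nat -> nat -> K) k :
  phi i (urow n b k) = if (k <= i)%N then b k i else 0.
Proof.
rewrite phi_prod => [|j _]; last exact: in_Uminus_y.
under eq_bigr => j _ do rewrite phi_y.
rewrite (perm_big (enum 'I_n)) /=; last by rewrite perm_rev.
rewrite big_enum_cond /= big_mkcond (bigD1 i) //= eqxx mul1r big1 ?addr0 // => j ji.
by rewrite eq_sym (negPf ji) mul0r if_same.
Qed.

Lemma phi_unip i (b : nat -> nat -> K) : phi i (unip n b) = \sum_(l < i.+1) b l i.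
Proof.
rewrite phi_prod => [|k _]; last exact: in_Uminus_urow.
rewrite (@big_cat_nat _ _ _ i.+1) //= [X in _ + X]big1_seq ?addr0 ?big_mkord => [|k].
  by apply: eq_bigr => k _; rewrite phi_urow -ltnS ltn_ord.
by rewrite mem_index_iota phi_urow => /andP[_ /andP[ik _]]; rewrite leqNgt ik.
Qed.

(** This is N_k; it interpolates between phi_i(theta(A)) at k = 0 and c times it for k > i. *)
Definition mix (c : K) i A (k : nat) : K :=
  \sum_(l < i.+1) (if (l < k)%N then c else 1) * an A l i.

Definition act (c : K) i A (p : tabA n) : K :=
  let M := mix c i A in
  if colA p == i then A p * (M (rowA p) / M (rowA p).+1)
  else if (colA p).+1 == i then A p * (M (rowA p).+1 / M (rowA p))
  else A p.

Lemma phi_theta i c A : phi i (theta_mx A) = mix c i A 0.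
Proof.
by rewrite theta_mxE phi_unip; apply: eq_bigr => l _; rewrite mul1r.
Qed.

Lemma mixS c i A k : mix c i A k.+1 = mix c i A k + (k <= i)%N%:R * (c - 1) * an A k i.
Proof.
rewrite /mix; case: leqP => ki; last first.
  rewrite !mul0r addr0; apply: eq_bigr => l _.
  by have li := ltn_ord l; rewrite !ifT //; lia.
pose x : 'I_i.+1 := Ordinal (ki : (k < i.+1)%N).
rewrite (bigD1 x) //= [X in _ = X + _](bigD1 x) //= ltnSn ltnn mul1r.
rewrite (eq_bigr (fun l : 'I_i.+1 => (if (l < k)%N then c else 1) * an A l i)) => [|l].
  by ring.
by rewrite ltnS leq_eqVlt -val_eqE /= => /negPf ->.
Qed.

Lemma mix_top c i A k : (i < k)%N -> mix c i A k = c * mix c i A 0.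
Proof.
move=> ik; rewrite /mix mulr_sumr; apply: eq_bigr => l _.
by have li := ltn_ord l; rewrite mul1r ifT //; lia.
Qed.

Section Crossing.
Variables (i : 'I_n) (s : K).

(* The image of [[p, s], [0, 1/p]] in the i-th SL_2.  Moving it to the right  *)
(* through y_i changes p but keeps the entry s.                               *)
Definition Xmx (p : K) : 'M[K]_n.+1 := coroot i p + s *: delta_mx (pos0 i) (pos1 i).

Lemma diag_delta (d : 'rV[K]_n.+1) r t : diag_mx d * delta_mx r t = d 0 r *: delta_mx r t.
Proof.
apply/matrixP => x y; rewrite -mulmxE mul_diag_mx !mxE.
by case: eqP => [->|] //; rewrite !mulr0.
Qed.

Lemma delta_diag (d : 'rV[K]_n.+1) r t : delta_mx r t * diag_mx d = d 0 t *: delta_mx r t.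
Proof.
apply/matrixP => x y; rewrite -mulmxE mul_mx_diag !mxE mulrC.
by case: (y =P t) => [->|] //; rewrite andbF !mulr0.
Qed.

Lemma pos_eqE (j : 'I_n) : [/\ (pos0 j == pos0 i) = (j == i), (pos1 j == pos1 i) = (j == i),
   (pos0 j == pos1 i) = (j == i.+1 :> nat) & (pos1 j == pos0 i) = (j.+1 == i :> nat)].
Proof. by split; rewrite -!val_eqE /= /bump ?add1n ?eqSS. Qed.

(** For j != i the products of E_{i,i+1} and E_{j+1,j} vanish in both orders, so only the torus part
    acts, by rescaling the parameter of y_j. *)
Lemma Xmx_y_ne (j : 'I_n) (p b : K) : p != 0 -> j != i ->
  Xmx p * y_ j b =
  y_ j (b * (if (j.+1 == i)%N || (j == i.+1 :> nat) then p else 1)) * Xmx p.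
Proof.
move=> p0 ji; have [e1 e2 e3 e4] := pos_eqE j.
rewrite /y_ [LHS]mulrDr [RHS]mulrDl mul1r mulr1; congr (_ + _).
rewrite -scalerAr -scalerAl /Xmx mulrDl mulrDr diag_delta delta_diag !mxE e1 e2 e3 e4.
rewrite -scalerAl -scalerAr -!mulmxE !mul_delta_mx_cond e1 [pos1 i == _]eq_sym e2 (negPf ji).
rewrite !mulr0n !scaler0 !addr0 !scalerA; congr (_ *: _).
case: (j.+1 =P i) => [ij|_] /=; first by rewrite (ltn_eqF (_ : j < i.+1)%N) ?mulr1 //; lia.
by case: ifP => _; rewrite ?mulr1 // mulfK.
Qed.

(** A 2 x 2 identity in the i-th SL_2: [[p,s],[0,1/p]] [[1,0],[b,1]] = [[1,0],[b/(pq),1]]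
    [[q,s],[0,1/q]]. *)
Lemma Xmx_y_eq (p q b : K) : p != 0 -> q != 0 -> q = p + s * b ->
  Xmx p * y_ i b = y_ i (b / (p * q)) * Xmx q.
Proof.
move=> p0 q0 qE; have [e1 e2 e3 e4] := pos_eqE i.
have E : coroot i p = coroot i q + ((p - q) *: delta_mx (pos0 i) (pos0 i) +
           (p^-1 - q^-1) *: delta_mx (pos1 i) (pos1 i)).
  apply/matrixP => x y; rewrite !mxE.
  case: (x =P y) => [->|xy] /=; last first.
    do 2!(case: andP => [[/eqP xa /eqP ya]|_]; first by case: xy; rewrite xa ya).
    by rewrite !mulr0 !mulr0n !addr0.
  rewrite !andbb !mulr1n; case: eqP => [->|_].
    by rewrite e3 (ltn_eqF (ltnSn i)) mulr1 mulr0 addr0 addrC subrK.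
  by case: eqP => _; rewrite !mulr0 add0r ?mulr1 ?addr0 // addrC subrK.
rewrite /y_ [LHS]mulrDr [RHS]mulrDl mul1r mulr1 -scalerAr -scalerAl.
rewrite /Xmx mulrDl mulrDr diag_delta delta_diag !mxE e1 e2 e3 e4 !eqxx.
rewrite (gtn_eqF (ltnSn i)) -scalerAl -scalerAr -!mulmxE !mul_delta_mx_cond !eqxx !mulr1n E.
rewrite !scalerDr !scalerA -!addrA; congr (_ + _).
set d00 := delta_mx _ _; set d01 := delta_mx _ _; set d11 := delta_mx _ _; set d10 := delta_mx _ _.
have -> : p - q = - (b * s) by rewrite qE; ring.
have -> : b / (p * q) * s = p^-1 - q^-1.
  have sb : s * b = q - p by rewrite qE; ring.
  rewrite mulrAC [b * s]mulrC sb; field; rewrite p0 q0 //.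
have -> : b / (p * q) * q = b / p by field; rewrite p0 q0.
rewrite scaleNr; set X1 := _ *: d00; set X2 := _ *: d11; set X3 := _ *: d01; set X4 := _ *: d10.
by rewrite addrC -!addrA subrr addr0 addrC -addrA.
Qed.

End Crossing.

Section Nondegenerate.
Variables (c : K) (i : 'I_n) (A : tabA n -> K).
Hypothesis M0 : forall k, mix c i A k != 0.
Hypothesis A0 : forall p, A p != 0.
Local Notation M := (mix c i A).

Lemma act_neq0 p : act c i A p != 0.
Proof. by rewrite /act; do !case: ifP => _; rewrite ?mulf_neq0 ?invr_neq0. Qed.

Lemma tab_act l (j : nat) : (l <= j)%N -> (j < n)%N ->
  tab (act c i A) l j = tab A l j *
    (if j == i then M l / M l.+1 else if j.+1 == i then M l.+1 / M l else 1).
Proof.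
move=> lj jn; have ln : (l < n)%N by lia.
pose p : tabA n := exist _ (Ordinal ln, Ordinal jn) lj.
rewrite (tab_val (act c i A) p : tab _ l j = _) (tab_val A p : tab _ l j = _).
rewrite /act /rowA /colA /=.
by case: ifP => // _; case: ifP => // _; rewrite mulr1.
Qed.

Lemma colprod_act k (j : nat) : (k <= j.+1)%N -> (j < n)%N ->
  colprod (act c i A) k j = colprod A k j *
    (if j == i then M 0 / M k else if j.+1 == i then M k / M 0 else 1).
Proof.
elim: k => [|k IH] kj jn.
  rewrite /colprod !big_ord0 divff ?M0 // !if_same mulr1 //.
rewrite /colprod !big_ord_recr /= -!/(colprod _ k j) IH ?tab_act //; last by lia.
have := M0 0; have := M0 k; have := M0 k.+1 => h1 h2 h3.
by do !case: ifP => _; field; rewrite ?h1 ?h2 ?h3.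
Qed.

(** The factors of [act] telescope in column products. The outcome is exactly the rescaling that y_j
    undergoes in [Xmx_urow]. *)
Lemma an_act k (j : nat) : (k <= j)%N -> (j < n)%N ->
  an (act c i A) k j = an A k j *
    (if j == i then (M 0 / M k) * (M 0 / M k.+1)
     else if j.+1 == i then M k.+1 / M 0
     else if j == i.+1 then M k / M 0 else 1).
Proof.
move=> kj jn; rewrite /an (colprod_act (k := k.+1)) //.
have P0 := colprod_neq0 k j.-1 A0.
have := M0 0; have := M0 k; have := M0 k.+1 => h1 h2 h3.
case: k kj P0 h1 h2 => [|k] kj P0 h1 h2.
  by rewrite !colprod0 !divr1 divff // !mul1r if_same.
case: j kj jn P0 => [|j] //= kj jn P0.
rewrite colprod_act //; last lia.
move: P0; set a := colprod A k.+1 j; set b := colprod A k.+2 j.+1 => P0.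
rewrite eqSS; case: (j =P i) => [->|ji].
  by rewrite !gtn_eqF //; field; rewrite P0 h2 h3.
case: (j.+1 =P i) => _.
  by field; rewrite P0 h1 h2 h3.
by case: ifP => _; field; rewrite ?P0 ?h1 ?h3.
Qed.

Local Notation S k := (M k / M 0).
Local Notation X := (Xmx i ((c - 1) / M 0)).

Lemma Xmx_urow k :
  X (S k) * urow n (an A) k = urow n (an (act c i A)) k * X (S k.+1).
Proof.
pose F (B : tabA n -> K) j : 'M[K]_n.+1 := if (k <= j)%N then y_ j (an B k j) else 1.
have UE B : urow n (an B) k = \prod_(j <- rev (enum 'I_n)) F B j.
  by rewrite /urow big_mkcond.
(* The diagonal parameter stays [S k] while the factors with j > i are crossed, and becomes [S k.+1]
   on crossing y_i. If k > i, the block has no y_i and the two parameters agree. *)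
pose st (j : nat) := if (j <= i)%N then S k.+1 else S k.
have S0 l : S l != 0 by rewrite mulf_neq0 ?invr_neq0.
have SS : S k.+1 = S k + (k <= i)%N%:R * ((c - 1) / M 0 * an A k i).
  by rewrite mixS; field; rewrite M0.
have := @prod_rev_ord_tele K n (fun l : nat => X (st l)) n (F A) (F (act c i A)).
rewrite -!UE /= /st leqNgt ltn_ord /=; apply => j; rewrite /F.
case: (leqP k j) => kj; last first.
  rewrite mulr1 mul1r; congr (X _); case: (ltngtP j i) => ji.
  - by [].
  - by [].
  - by rewrite SS leqNgt -ji kj mul0r addr0.
have jn := ltn_ord j.
rewrite an_act // val_eqE; case: (altP (j =P i)) => [ji|ji].
  move: kj; rewrite ji leqnn ltnn => ki.
  rewrite (Xmx_y_eq i (S0 k) (S0 k.+1)); last by rewrite SS ki mul1r.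
  by congr (y_ _ _ * _); field; rewrite !M0.
have ji' := ji; rewrite -val_eqE /= in ji'; rewrite -/(pos0 j).
case: (ltngtP j i) ji' => // ji' _.
  rewrite (Xmx_y_ne _ _ (S0 k.+1) ji); congr (y_ _ (_ * _) * _).
  by rewrite [j == i.+1 :> nat]ltn_eqF ?orbF // ltnW.
rewrite (Xmx_y_ne _ _ (S0 k) ji); congr (y_ _ (_ * _) * _).
by rewrite [j.+1 == i]gtn_eqF //= ltnW.
Qed.

(** The parameter of X starts at M_0/M_0 = 1, where X is x_i itself, and ends at M_n/M_0 = c, since
    n > i. The remaining X then splits into a torus and a unipotent factor. *)
Lemma x_theta : c != 0 -> x_ i ((c - 1) / M 0) * theta_mx A =
  theta_mx (act c i A) * coroot i c * x_ i ((c - 1) / M 0 / c).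
Proof.
move=> c0.
have := @prod_ord_tele K n (fun k => X (S k)) n (urow n (an A)) (urow n (an (act c i A))).
move=> /(_ (fun k _ => Xmx_urow k)); rewrite -!/(utail _ _ 0) -!/(unip _ _) -!theta_mxE /=.
rewrite (mix_top _ _ (ltn_ord i)) mulfK ?M0 // divff ?M0 //.
have -> : X 1 = x_ i ((c - 1) / M 0).
  congr (_ + _); apply/matrixP => x y; rewrite !mxE invr1 !if_same.
  by case: eqP.
rewrite -mulrA => ->; congr (_ * _).
rewrite /Xmx /x_ mulrDr mulr1; congr (_ + _).
rewrite -scalerAr diag_delta !mxE eqxx scalerA divfK //.
Qed.

End Nondegenerate.

(** Uniqueness of the triangular factorization, determining alternately row s of the upper factor
    and column s of the lower one. *)
Lemma lower_upper_inj (l l' t t' : 'M[K]_n.+1) : in_Uminus l -> in_Uminus l' ->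
  (forall r s : 'I_n.+1, (s < r)%N -> t r s = 0) ->
  (forall r s : 'I_n.+1, (s < r)%N -> t' r s = 0) ->
  (forall s, t s s != 0) -> l * t = l' * t' -> l = l'.
Proof.
move=> Ul Ul' Ut Ut' t0 E.
suff H (s : nat) : forall x : 'I_n.+1, x = s :> nat ->
    (forall r, l r x = l' r x) /\ (forall r, t x r = t' x r).
  by apply/matrixP => r x; have [] := H x x.
elim/ltn_ind: s => s IH x xs.
have tE r : t x r = t' x r.
  have /matrixP/(_ x r) := E; rewrite !mxE (bigD1 x) //= [RHS](bigD1 x) //= Ul // Ul' //.
  rewrite eqxx !mul1r [X in _ + X = _](eq_bigr (fun y => l' x y * t' y r)).
    by move/addIr.
  move=> y yx; case: (ltngtP x y) => [xy|yx'|/val_inj yx'].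
  - by rewrite Ul 1?ltnW // Ul' 1?ltnW // -val_eqE (ltn_eqF xy) !mul0r.
  - by have [-> ->] := IH y (leq_trans yx' (eq_leq xs)) y erefl.
  - by rewrite yx' eqxx in yx.
split=> // r; have /matrixP/(_ r x) := E.
rewrite !mxE (bigD1 x) //= [RHS](bigD1 x) //= tE.
have tx : t' x x != 0 by rewrite -tE.
rewrite [X in _ + X = _](eq_bigr (fun y => l' r y * t' y x)).
  by move/addIr/(mulIf tx).
move=> y yx; case: (ltngtP x y) => [xy|yx'|/val_inj yx'].
- by rewrite Ut ?Ut' ?mulr0.
- by have [-> ->] := IH y (leq_trans yx' (eq_leq xs)) y erefl.
- by rewrite yx' eqxx in yx.
Qed.

Lemma pi_mmE (l d r : 'M[K]_n.+1) : in_Uminus l -> in_T d -> in_Uplus r -> pi_mm (l * d * r) = l.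
Proof.
move=> Ul Td Ur; apply: xget_unique => [|l' /= [Ul' [d' [r' [Td' Ur' E]]]]].
  by split=> //; exists d, r.
have upper (e q : 'M[K]_n.+1) : in_T e -> in_Uplus q -> forall x y : 'I_n.+1, (y <= x)%N ->
    (e * q) x y = e x x * (x == y)%:R.
  move=> [/is_diag_mxP De _] Uq x y yx; rewrite mxE (bigD1 x) //= big1 ?addr0 => [|z zx].
    by have := Uq y x yx; rewrite mxE eq_sym => ->.
  by rewrite De ?mul0r // eq_sym.
rewrite -!mulrA in E.
apply: (lower_upper_inj Ul' Ul _ _ _ (esym E)) => [x y|x y|x].
- by move=> yx; rewrite upper ?(ltnW yx) // -val_eqE gtn_eqF ?mulr0.
- by move=> yx; rewrite upper ?(ltnW yx) // -val_eqE gtn_eqF ?mulr0.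
rewrite upper // eqxx mulr1; case: Td' => /is_diag_mxP Dd' dd'.
apply/eqP => dx; have := oner_eq0 K; rewrite -dd' det_trig.
  by rewrite (bigD1 x) //= dx mul0r eqxx.
by apply/is_trig_mxP => y z yz; rewrite Dd' // neq_ltn yz.
Qed.

Lemma coroot_in_T i (c : K) : c != 0 -> in_T (coroot i c).
Proof.
move=> c0; split; first by apply/diag_mx_is_diag.
rewrite det_diag (bigD1 (pos0 i)) //= (bigD1 (pos1 i)) /=; last first.
  by rewrite -val_eqE /= /bump add1n gtn_eqF.
rewrite !mxE !eqxx -val_eqE /= /bump add1n gtn_eqF // mulVKf // big1 // => r /andP[r0 r1].
by rewrite mxE (negPf r0) (negPf r1).
Qed.

Lemma x_in_Uplus i (c : K) : in_Uplus (x_ i c).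
Proof.
suff E : (x_ i c)^T = y_ i c by rewrite /in_Uplus E; apply: in_Uminus_y.
by apply/matrixP => x y; rewrite !mxE [y == x]eq_sym andbC.
Qed.

Lemma e_theta_mx i c A : (forall k, mix c i A k != 0) -> (forall p, A p != 0) ->
  c != 0 -> e_ i c (theta_mx A) = theta_mx (act c i A).
Proof.
move=> M0 A0 c0; rewrite /e_ (phi_theta i c A) x_theta // pi_mmE //.
- exact: in_Uminus_theta.
- exact: coroot_in_T.
- exact: x_in_Uplus.
Qed.

Lemma e_generic i c u : generic u -> c != 0 ->
  (forall k, mix c i (theta_inv u) k != 0) ->
  e_ i c u = theta_mx (act c i (theta_inv u)).
Proof.
move=> gu c0 M0; rewrite -{1}(theta_invK gu) e_theta_mx // => p.
exact: theta_inv_neq0.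
Qed.

End Action.

(* A place in the sense of valuation theory, as a partial map: h f y reads    *)
(* "f is finite at h and takes the value y".                                  *)
Record place (K0 K : fieldType) (h : K0 -> K -> Prop) : Prop := Place {
  place1 : h 1 1;
  placeB : forall f g y z, h f y -> h g z -> h (f - g) (y - z);
  placeM : forall f g y z, h f y -> h g z -> h (f * g) (y * z);
  placeV : forall f y, h f y -> y != 0 -> h f^-1 y^-1;
  place_eq0 : forall y, h 0 y -> y = 0
}.

(** * Transport of the matrix formulas along a place *)

Section Place.
Variables (K0 K : fieldType) (h : K0 -> K -> Prop).
Hypothesis hP : place h.
Implicit Types (f g : K0) (y z : K).

Lemma place_uniq f y z : h f y -> h f z -> y = z.
Proof.
move=> fy fz; apply/eqP; rewrite -subr_eq0; apply/eqP/(place_eq0 hP).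
by have := placeB hP fy fz; rewrite subrr.
Qed.

(** The source of nonvanishing in the function fields: specialize to a point where the value is
    known to be nonzero. *)
Lemma place_neq0 f y : h f y -> y != 0 -> f != 0.
Proof. by move=> fy; apply: contraNneq => f0; apply/eqP/(place_eq0 hP); rewrite -f0. Qed.

Lemma place0 : h 0 0.
Proof. by have := placeB hP (place1 hP) (place1 hP); rewrite !subrr. Qed.

Lemma placeN f y : h f y -> h (- f) (- y).
Proof. by move=> fy; have := placeB hP place0 fy; rewrite !sub0r. Qed.

Lemma placeD f g y z : h f y -> h g z -> h (f + g) (y + z).
Proof. by move=> fy gz; have := placeB hP fy (placeN gz); rewrite !opprK. Qed.

Lemma place_div f g y z : h f y -> h g z -> z != 0 -> h (f / g) (y / z).
Proof. by move=> fy gz z0; apply: (placeM hP) => //; apply: (placeV hP). Qed.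

Lemma place_sum (I : Type) (l : seq I) (P : pred I) (F : I -> K0) (G : I -> K) :
  (forall x, P x -> h (F x) (G x)) ->
  h (\sum_(x <- l | P x) F x) (\sum_(x <- l | P x) G x).
Proof. by move=> H; apply: big_ind2 => //; [exact: place0 | move=> *; apply: placeD]. Qed.

Lemma place_prod (I : Type) (l : seq I) (P : pred I) (F : I -> K0) (G : I -> K) :
  (forall x, P x -> h (F x) (G x)) ->
  h (\prod_(x <- l | P x) F x) (\prod_(x <- l | P x) G x).
Proof. by move=> H; apply: big_ind2 => //; [exact: (place1 hP) | move=> *; apply: (placeM hP)]. Qed.

Lemma place_nat k : h k%:R k%:R.
Proof.
elim: k => [|k IH]; first exact: place0.
by have := placeD (place1 hP) IH; rewrite -!mulrS.
Qed.

Lemma place_det k (M : 'M[K0]_k) (N : 'M[K]_k) :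
  (forall r s, h (M r s) (N r s)) -> h (\det M) (\det N).
Proof.
move=> H; apply: place_sum => s _; apply: (placeM hP); last by apply: place_prod.
by case: (odd_perm s); rewrite ?expr1 ?expr0; [apply: placeN|]; apply: (place1 hP).
Qed.

Section Tableaux.
Variable n : nat.
Implicit Types (u : 'M[K0]_n.+1) (w : 'M[K]_n.+1) (A : tabA n -> K0) (B : tabA n -> K).

Definition mx_place u w := forall r s, h (u r s) (w r s).

Lemma mx_place1 : mx_place 1 1.
Proof. by move=> r s; rewrite !mxE; apply: place_nat. Qed.

Lemma mx_placeM u w u' w' : mx_place u w -> mx_place u' w' -> mx_place (u * u') (w * w').
Proof.
by move=> H H' r s; rewrite !mxE; apply: place_sum => t _; apply: (placeM hP).
Qed.

Lemma mx_place_prod (I : Type) (l : seq I) (P : pred I) (F : I -> 'M[K0]_n.+1)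
    (G : I -> 'M[K]_n.+1) :
  (forall x, P x -> mx_place (F x) (G x)) ->
  mx_place (\prod_(x <- l | P x) F x) (\prod_(x <- l | P x) G x).
Proof. by move=> H; apply: big_ind2 => //; [exact: mx_place1 | exact: mx_placeM]. Qed.

Lemma place_minor u w m k s : mx_place u w -> h (minor u m k s) (minor w m k s).
Proof. by move=> H; apply: place_det => x y; rewrite !mxE; apply: H. Qed.

Lemma place_theta_inv u w p : mx_place u w -> generic w -> h (theta_inv u p) (theta_inv w p).
Proof.
move=> H gw; have := row_le_col p; have := col_lt p => cn rc.
by do !apply: place_div; rewrite ?minor_ratio_neq0 ?(proj2 gw) //; try apply: place_minor; try lia.
Qed.

Variables (A : tabA n -> K0) (B : tabA n -> K).
Hypothesis AB : forall p, h (A p) (B p).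
Hypothesis B0 : forall p, B p != 0.

Lemma place_colprod k j : h (colprod A k j) (colprod B k j).
Proof. by do 2!apply: place_prod => ? _. Qed.

Lemma place_an k j : h (an A k j) (an B k j).
Proof. by apply: place_div; rewrite ?colprod_neq0 //; apply: place_colprod. Qed.

Lemma place_theta : mx_place (theta_mx A) (theta_mx B).
Proof.
rewrite !theta_mxE; do 2!apply: mx_place_prod => ? _; move=> r s; rewrite !y_E.
by apply: placeD; [|apply: (placeM hP); [apply: place_an|]]; apply: place_nat.
Qed.

Lemma place_mix c d i k : h c d -> h (mix c i A k) (mix d i B k).
Proof.
move=> cd; apply: place_sum => l _; apply: (placeM hP); last exact: place_an.
by case: ifP => // _; apply: (place1 hP).
Qed.

Lemma place_act c d i p : h c d -> (forall k, mix d i B k != 0) ->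
  h (act c i A p) (act d i B p).
Proof.
move=> cd M0; rewrite /act; do 2?[case: ifP => _] => //.
  by apply: (placeM hP) => //; apply: place_div => //; apply: place_mix.
by apply: (placeM hP) => //; apply: place_div => //; apply: place_mix.
Qed.

End Tableaux.
End Place.

(** * Values of rational functions and uniqueness of rational inverses *)

Section Values.
Variables (R : realType) (I : finType) (K : fieldType).
Variables (iota : {rmorphism R[i] -> K}) (x : I -> K).
Local Notation at_x := (mpoly_at iota x).

Lemma mpoly_atM P Q : at_x (P * Q) = at_x P * at_x Q.
Proof. exact: rmorphM. Qed.

Lemma mpoly_atB P Q : at_x (P - Q) = at_x P - at_x Q.
Proof. exact: rmorphB. Qed.

Lemma mpoly_at1 : at_x 1 = 1.
Proof. exact: rmorph1. Qed.

Lemma mpoly_at0 : at_x 0 = 0.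
Proof. exact: rmorph0. Qed.

Lemma mpoly_at_neq0 P : at_x P != 0 -> tofrac P != 0.
Proof.
by rewrite tofrac_eq0; apply: contraNneq => ->; rewrite mpoly_at0.
Qed.

Lemma has_value_place : place (@has_value R I K iota x).
Proof.
split.
- by exists 1, 1; rewrite mpoly_at1 oner_neq0 tofrac1 !divr1.
- move=> f g y z [P [Q [Q0 -> ->]]] [P' [Q' [Q0' -> ->]]].
  exists (P * Q' - P' * Q), (Q * Q'); rewrite mpoly_atB !mpoly_atM mulf_neq0 //.
  rewrite tofracB !tofracM -!mulNr !addf_div ?mpoly_at_neq0 //.
- move=> f g y z [P [Q [Q0 -> ->]]] [P' [Q' [Q0' -> ->]]].
  exists (P * P'), (Q * Q'); rewrite !mpoly_atM mulf_neq0 //.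
  by rewrite !tofracM !mulf_div.
- move=> f y [P [Q [Q0 -> ->]]] y0; exists Q, P; rewrite !invf_div; split=> //.
  by apply: contraNneq y0 => ->; rewrite mul0r.
- move=> y [P [Q [Q0 E ->]]]; move/esym/eqP: E.
  rewrite mulf_eq0 invr_eq0 (negPf (mpoly_at_neq0 Q0)) orbF tofrac_eq0 => /eqP ->.
  by rewrite mpoly_at0 mul0r.
Qed.

Lemma has_value_poly P : has_value iota x (tofrac P) (at_x P).
Proof. by exists P, 1; rewrite mpoly_at1 oner_neq0 tofrac1 !divr1. Qed.

Lemma has_value_ratid p : has_value iota x (@ratid R I p) (x p).
Proof.
have := has_value_poly 'X_(enum_rank p).
by rewrite /mpoly_at mmapX mmap1U enum_rankK.
Qed.

Lemma has_value_const c : has_value iota x (@ratfunC R I c) (iota c).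
Proof. by have := has_value_poly c%:MP; rewrite /mpoly_at mmapC. Qed.

Lemma valueE f y : has_value iota x f y -> value iota x f = y.
Proof.
move=> fy; apply: xget_unique => // z fz; exact: (place_uniq has_value_place fz fy).
Qed.

End Values.

Lemma place_mpoly_at (R : realType) (I : finType) (K0 K : fieldType)
    (h : K0 -> K -> Prop) (iota0 : {rmorphism R[i] -> K0}) (iota : {rmorphism R[i] -> K})
    (x0 : I -> K0) (x : I -> K) (P : {mpoly R[i][#|I|]}) :
  place h -> (forall c, h (iota0 c) (iota c)) -> (forall p, h (x0 p) (x p)) ->
  h (mpoly_at iota0 x0 P) (mpoly_at iota x P).
Proof.
move=> hP hc hx; apply: place_sum => // m _; apply: placeM => //.
apply: place_prod => // k _; elim: (m k) => [|e IH]; first exact: place1.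
by rewrite !exprS; apply: placeM.
Qed.

Lemma mpoly_at_ratid (R : realType) (I : finType) (P : {mpoly R[i][#|I|]}) :
  mpoly_at (@ratfunC R I) (@ratid R I) P = tofrac P.
Proof.
rewrite [in RHS](mpolyE P) rmorph_sum; apply: eq_bigr => m _ /=.
rewrite -mul_mpolyC rmorphM; congr (_ * _).
rewrite [in RHS]mpolyXE_id rmorph_prod; apply: eq_bigr => k _.
by rewrite rmorphXn /ratid enum_valK.
Qed.

(** Since [ratinv] is a choice, it can be computed only through uniqueness. Here g p - g' p = P/Q
    with P vanishing at f; evaluating P(f) at g returns P itself, because g is an inverse, so P =
    0. *)
Lemma ratinverse_inj (R : realType) (I J : finType) (f : ratmap R I J) (g g' : ratmap R J I) :
  is_ratinverse f g -> is_ratinverse f g' -> g = g'.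
Proof.
move=> [fg gf] [fg' _]; apply/funext => p; apply/eqP; rewrite -subr_eq0.
have := placeB (has_value_place _ _) (fg p) (fg' p).
rewrite subrr => -[P [Q [Q0 -> /eqP]]].
rewrite eq_sym mulf_eq0 invr_eq0 (negPf Q0) orbF => /eqP P0.
have hP := has_value_place (@ratfunC R J) g.
have := place_mpoly_at P hP (has_value_const _ _) gf.
by rewrite P0 mpoly_at_ratid => /(place_eq0 hP) ->; rewrite mul0r.
Qed.

Lemma ratinvE (R : realType) (I J : finType) (f : ratmap R I J) (g : ratmap R J I) :
  is_ratinverse f g -> ratinv f = g.
Proof. by move=> fg; apply: xget_unique => // g' fg'; apply: ratinverse_inj fg' fg. Qed.

(** * Degrees of subtraction-free rational functions *)

Section Fractions.
Local Open Scope quotient_scope.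
Variable D : idomainType.

Lemma fracE (g : {fraction D}) :
  g = tofrac (\n_(generic_quotient.repr g)) / tofrac (\d_(generic_quotient.repr g)).
Proof.
have d0 : tofrac (\d_(generic_quotient.repr g)) != 0 by rewrite tofrac_eq0 denom_ratioP.
apply: (mulIf d0); rewrite divfK //.
have H (x : {ratio D}) : FracField.mul (\pi_({fraction D})%qT x) (tofrac \d_x) = tofrac \n_x.
  rewrite !piE /FracField.mulf; apply/eqmodP; rewrite /= FracField.equivfE.
  by rewrite !numden_Ratio ?mulf_neq0 ?denom_ratioP ?oner_eq0 // !mulr1 mulrC.
by rewrite -{1}[g]reprK; apply: H.
Qed.
End Fractions.

Section Degree.
Variable R : realType.
Local Notation C := R[i].
Implicit Types (p q : {poly C}) (g : ratfun1 R) (d : int).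

(** [vdeg] reads the chosen representative; cross-multiplication makes it independent of that
    choice. Sizes exceed degrees by one, which cancels in the difference. *)
Lemma vdeg_frac p q : p != 0 -> q != 0 ->
  vdeg (tofrac p / tofrac q : ratfun1 R) = (size p)%:Z - (size q)%:Z.
Proof.
move=> p0 q0; rewrite /vdeg; set g : {fraction {poly C}} := _ / _.
have := fracE g; set N := \n_ _; set D := \d_ _ => gE.
have D0 : D != 0 by apply: denom_ratioP.
have fq0 : tofrac q != 0 by rewrite tofrac_eq0.
have fD0 : tofrac D != 0 by rewrite tofrac_eq0.
have : tofrac (p * D) == tofrac (N * q).
  by rewrite !tofracM -(eqr_div _ _ fq0 fD0) -gE.
rewrite tofrac_eq => /eqP E.
have N0 : N != 0.
  by apply: contraTneq (mulf_neq0 p0 D0) => N0; rewrite E N0 mul0r eqxx.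
have := congr1 (fun r : {poly C} => size r) E; rewrite !size_mul // => sE.
have H (a b c e : nat) : (0 < a)%N -> (0 < b)%N -> (0 < c)%N -> (0 < e)%N ->
  (a + b).-1 = (c + e).-1 -> c%:Z - b%:Z = a%:Z - e%:Z by lia.
by apply: H sE; rewrite size_poly_gt0.
Qed.

Lemma positive_lead p : positive_poly p -> 0 < lead_coef p.
Proof.
move=> [p0 /polyOverP pp]; rewrite lt_def lead_coef_eq0 p0.
by have := pp (size p).-1; rewrite nnegrE -lead_coefE.
Qed.

Lemma positive_polyM p q : positive_poly p -> positive_poly q -> positive_poly (p * q).
Proof.
move=> [p0 /polyOverP pp] [q0 /polyOverP qq]; split; first by rewrite mulf_neq0.
apply/polyOverP => k; rewrite coefM nnegrE; apply: sumr_ge0 => l _.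
by apply: mulr_ge0; [have := pp l | have := qq (k - l)%N]; rewrite nnegrE.
Qed.

(** Nonnegative coefficients cannot cancel a positive leading one, so the degree of a sum is the
    maximum. This is where tropical addition comes from. *)
Lemma positive_polyD p q : positive_poly p -> positive_poly q ->
  positive_poly (p + q) /\ size (p + q) = maxn (size p) (size q).
Proof.
wlog qp : p q / (size q <= size p)%N => [H Pp Pq|Pp Pq].
  have [qp|pq] := orP (leq_total (size q) (size p)); first exact: H.
  by rewrite addrC maxnC; apply: H.
have lp := positive_lead Pp; have [p0 pp] := Pp; have [q0 qq] := Pq.
have lpq : (p + q)`_(size p).-1 != 0.
  rewrite coefD paddr_eq0 ?(ltW lp) //; first by rewrite (gt_eqF lp).
  by have /polyOverP/(_ (size p).-1) := qq; rewrite nnegrE.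
have s1 : (size p <= size (p + q)%R)%N.
  rewrite leqNgt; apply: contra lpq => lt.
  by rewrite nth_default // -ltnS prednK // size_poly_gt0.
have -> : maxn (size p) (size q) = size p by lia.
split; last by apply/eqP; rewrite eqn_leq s1 (leq_trans (size_polyD _ _)) // geq_max leqnn.
split; last first.
  apply/polyOverP => k; rewrite coefD nnegrE addr_ge0 //.
    by have /polyOverP/(_ k) := pp; rewrite nnegrE.
  by have /polyOverP/(_ k) := qq; rewrite nnegrE.
by rewrite -size_poly_gt0 (leq_trans _ s1) // size_poly_gt0.
Qed.

(** Positivity and degree in one predicate, stable under products, inverses and sums: a single
    derivation then yields both the positive structure and the ultra-discretization. *)
Definition posdeg g d := exists p q : {poly C},
  [/\ positive_poly p, positive_poly q, g = tofrac p / tofrac q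
    & d = (size p)%:Z - (size q)%:Z].

Lemma posdeg_vdeg g d : posdeg g d -> vdeg g = d.
Proof. by move=> [p [q [[p0 _] [q0 _] -> ->]]]; apply: vdeg_frac. Qed.

Lemma posdeg_positive g d : posdeg g d -> positive_ratfun1 g.
Proof. by move=> [p [q [? ? ? _]]]; exists p, q. Qed.

Lemma posdeg_neq0 g d : posdeg g d -> g != 0.
Proof.
by move=> [p [q [[p0 _] [q0 _] -> _]]]; rewrite mulf_neq0 ?invr_neq0 ?tofrac_eq0.
Qed.

Lemma positive_poly1 : positive_poly (1 : {poly C}).
Proof.
split; first exact: oner_neq0.
by apply/polyOverP => k; rewrite coef1 nnegrE ler0n.
Qed.

Lemma posdeg1 : posdeg 1 0.
Proof.
exists 1, 1; split; rewrite ?subrr //; try exact: positive_poly1.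
by rewrite tofrac1 divr1.
Qed.

Lemma posdegM g g' d d' : posdeg g d -> posdeg g' d' -> posdeg (g * g') (d + d').
Proof.
move=> [p [q [Pp Pq -> ->]]] [p' [q' [Pp' Pq' -> ->]]].
exists (p * p'), (q * q'); split; try exact: positive_polyM.
  by rewrite !tofracM mulf_div.
case: Pp Pq Pp' Pq' => [p0 _] [q0 _] [p0' _] [q0' _]; rewrite !size_mul //.
have H (a b c e : nat) : (0 < a)%N -> (0 < b)%N -> (0 < c)%N -> (0 < e)%N ->
  a%:Z - b%:Z + (c%:Z - e%:Z) = (a + c).-1%:Z - (b + e).-1%:Z by lia.
by apply: H; rewrite size_poly_gt0.
Qed.

Lemma posdegV g d : posdeg g d -> posdeg g^-1 (- d).
Proof. by move=> [p [q [Pp Pq -> ->]]]; exists q, p; rewrite invf_div opprB. Qed.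

Lemma posdeg_div g g' d d' : posdeg g d -> posdeg g' d' -> posdeg (g / g') (d - d').
Proof. by move=> H /posdegV; apply: posdegM. Qed.

Lemma posdegD g g' d d' : posdeg g d -> posdeg g' d' -> posdeg (g + g') (Num.max d d').
Proof.
move=> [p [q [Pp Pq -> ->]]] [p' [q' [Pp' Pq' -> ->]]].
have [P1 P2] := (positive_polyM Pp Pq', positive_polyM Pp' Pq).
have [P3 sE] := positive_polyD P1 P2.
exists (p * q' + p' * q), (q * q'); split=> //; first exact: positive_polyM.
  by rewrite tofracD !tofracM addf_div // tofrac_eq0; [case: Pq | case: Pq'].
case: Pp Pq Pp' Pq' => [p0 _] [q0 _] [p0' _] [q0' _]; rewrite sE !size_mul //.
have H (a b c e : nat) : (0 < a)%N -> (0 < b)%N -> (0 < c)%N -> (0 < e)%N ->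
  Num.max (a%:Z - b%:Z) (c%:Z - e%:Z) = (maxn (a + e).-1 (c + b).-1)%:Z - (b + e).-1%:Z by lia.
by apply: H; rewrite size_poly_gt0.
Qed.

Lemma posdeg_prod (I : Type) (r : seq I) (P : pred I) F (f : I -> int) :
  (forall x, P x -> posdeg (F x) (f x)) ->
  posdeg (\prod_(x <- r | P x) F x) (\sum_(x <- r | P x) f x).
Proof.
by move=> H; apply: big_ind2 => //; [exact: posdeg1 | move=> *; apply: posdegM].
Qed.

(** The separate summand [g] provides the initial value of the maximum, as the integers have no
    least element. *)
Lemma posdeg_sum (I : Type) (r : seq I) (P : pred I) F (f : I -> int) g d :
  posdeg g d -> (forall x, P x -> posdeg (F x) (f x)) ->
  posdeg (g + \sum_(x <- r | P x) F x) (\big[Num.max/d]_(x <- r | P x) f x).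
Proof.
move=> gd H; elim: r => [|x r IH]; first by rewrite !big_nil addr0.
rewrite !big_cons; case: ifP => // Px; rewrite addrCA.
by apply: posdegD => //; apply: H.
Qed.

Lemma posdegX d : posdeg (tofrac 'X ^ d) d.
Proof.
have X : posdeg (tofrac 'X) 1.
  exists 'X, 1; split; try exact: positive_poly1; last by rewrite size_polyX size_poly1.
    split; first by rewrite polyX_eq0.
    by apply/polyOverP => k; rewrite coefX nnegrE ler0n.
  by rewrite tofrac1 divr1.
have H (k : nat) : posdeg (tofrac 'X ^+ k) k.
  elim: k => [|k IH]; first exact: posdeg1.
  by rewrite exprS intS; apply: posdegM.
by case: d => k; [exact: H | exact: (posdegV (H k.+1))].
Qed.

End Degree.

(** * Tropical counterparts of [colprod], [an], [mix] and [act] *)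

Section Tropical.
Variable n : nat.
Implicit Types (l : tabA n -> int) (d : int) (i : 'I_n).

Definition tcol l k (j : nat) : int :=
  \sum_(p : tabA n | (colA p == j) && (rowA p < k)%N) l p.
Definition tan l k (j : nat) : int := tcol l k.+1 j - tcol l k j.-1.
Definition tmix_term d i l k (m : nat) : int := (if (m < k)%N then d else 0) + tan l m i.
Definition tmix d i l k : int :=
  \big[Num.max/tmix_term d i l k 0]_(m < i) tmix_term d i l k m.+1.
Definition tact d i l (p : tabA n) : int :=
  let M := tmix d i l in
  if colA p == i then l p + (M (rowA p) - M (rowA p).+1)
  else if (colA p).+1 == i then l p + (M (rowA p).+1 - M (rowA p))
  else l p.

Variable R : realType.
Variables (A : tabA n -> ratfun1 R) (l : tabA n -> int).
Hypothesis Al : forall p, posdeg (A p) (l p).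

Lemma posdeg_an k (j : nat) : posdeg (an A k j) (tan l k j).
Proof. by apply: posdeg_div; rewrite -colprodE; apply: posdeg_prod. Qed.

Lemma posdeg_mix c d i k : posdeg c d -> posdeg (mix c i A k) (tmix d i l k).
Proof.
move=> cd.
have H (m : nat) : posdeg ((if (m < k)%N then c else 1) * an A m i) (tmix_term d i l k m).
  apply: posdegM; last exact: posdeg_an.
  by case: ifP => // _; apply: posdeg1.
by rewrite /mix big_ord_recl; apply: posdeg_sum => // m _; apply: (H m.+1).
Qed.

Lemma posdeg_act c d i p : posdeg c d -> posdeg (act c i A p) (tact d i l p).
Proof.
move=> cd; rewrite /act /tact.
by do 2?[case: ifP => _] => //; apply: posdegM => //; apply: posdeg_div; apply: posdeg_mix.
Qed.

End Tropical.

(** * The rational maps over function fields, and their degrees on cocharacters *)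

Section Coordinates.
Variables (R : realType) (n : nat).

Lemma in_Uminus_mx_of_low (K : fieldType) (x : low n -> K) : in_Uminus (mx_of_low x).
Proof. by move=> r s rs; rewrite mxE insubF //= ltnNge rs. Qed.

Lemma mx_place_low (K0 K : fieldType) (h : K0 -> K -> Prop) (x : low n -> K0) (y : low n -> K) :
  place h -> (forall p, h (x p) (y p)) -> mx_place h (mx_of_low x) (mx_of_low y).
Proof.
by move=> hP H r s; rewrite !mxE; case: insubP => // _; apply: place_nat.
Qed.

Lemma generic_place (K0 K : fieldType) (h : K0 -> K -> Prop) (u : 'M[K0]_n.+1) (w : 'M[K]_n.+1) :
  place h -> mx_place h u w -> in_Uminus u -> generic w -> generic u.
Proof.
move=> hP H Uu [_ nz]; split=> // k s ks.
by apply: (place_neq0 hP (place_minor hP _ _ _ H)); apply: nz.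
Qed.

Lemma generic_theta (K : fieldType) (A : tabA n -> K) :
  (forall p, A p != 0) -> generic (theta_mx A).
Proof. by move=> A0; split; [apply: in_Uminus_theta | move=> *; apply: minor_theta_neq0]. Qed.

Lemma ratid_neq0 (I : finType) (p : I) : ratid R p != 0.
Proof.
rewrite /ratid tofrac_eq0; apply/eqP => X0.
by have := congr1 (mcoeff U_(enum_rank p)) X0; rewrite mcoeffX eqxx mcoeff0; apply/eqP/oner_neq0.
Qed.

Lemma theta_hatK : mx_of_low (theta_hat R n) = theta_mx (@ratid R (tabA n)).
Proof. by apply: low_of_mxK; apply: in_Uminus_theta. Qed.

Definition low_mx : 'M[ratfun R (low n)]_n.+1 := mx_of_low (@ratid R (low n)).
Definition theta_hat_inv : ratmap R (low n) (tabA n) := theta_inv low_mx.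

Local Notation at_theta := (has_value (@ratfunC R (tabA n)) (theta_hat R n)).

Lemma place_low_mx : mx_place at_theta low_mx (theta_mx (@ratid R (tabA n))).
Proof.
rewrite -theta_hatK; apply: mx_place_low; first exact: has_value_place.
exact: has_value_ratid.
Qed.

Lemma generic_low_mx : generic low_mx.
Proof.
apply: (generic_place (has_value_place _ _) place_low_mx); first exact: in_Uminus_mx_of_low.
by apply: generic_theta => p; apply: ratid_neq0.
Qed.

(** One composite specializes [theta_inv] at theta and uses [theta_mxK]; the other applies
    [theta_invK] to the generic unitriangular matrix. *)
Lemma theta_hat_invP : is_ratinverse (theta_hat R n) theta_hat_inv.
Proof.
split=> [p|q].
  rewrite -(theta_mxK (@ratid_neq0 (tabA n)) p).
  apply: place_theta_inv place_low_mx _; first exact: has_value_place.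
  by apply: generic_theta => ?; apply: ratid_neq0.
have hP := has_value_place (@ratfunC R (low n)) theta_hat_inv.
have := place_theta hP (has_value_ratid _ _) (fun p => theta_inv_neq0 p generic_low_mx).
rewrite theta_invK; last exact: generic_low_mx.
move/(_ (val q).1 (val q).2); rewrite /theta_hat /low_of_mx.
by rewrite -/(low_of_mx low_mx q) /low_mx mx_of_lowK.
Qed.

(* The generic point of T_0 inside C^* x T_0. *)
Local Notation A1 := (fun p : tabA n => @ratid R (option (tabA n)) (Some p)).
Local Notation c1 := (@ratid R (option (tabA n)) None).
Local Notation Ie := (option (tabA n)).
Local Notation Je := (option (low n)).

Lemma A1_neq0 p : A1 p != 0. Proof. exact: ratid_neq0. Qed.

Lemma ratpar_theta : ratpar (theta_hat R n) =
  fun q => if q is Some q' then low_of_mx (theta_mx A1) q' else c1.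
Proof.
apply/funext => -[q|] //=; apply: valueE.
have hP := has_value_place (@ratfunC R Ie) A1.
exact: (place_theta hP (has_value_ratid _ _) A1_neq0).
Qed.

Section Cocharacter.
Variable l : {ffun option (tabA n) -> int}.
Local Notation at_l := (has_value (@ratfun1C R) (cocharacter R l)).

Lemma posdeg_cochar (I : finType) (l' : {ffun I -> int}) p :
  posdeg (cocharacter R l' p) (l' p).
Proof. exact: posdegX. Qed.

Lemma cochar_neq0 (I : finType) (l' : {ffun I -> int}) p : cocharacter R l' p != 0.
Proof. exact: posdeg_neq0 (posdeg_cochar l' p). Qed.

Lemma cochar_mix i k : mix (cocharacter R l None) i (fun p => cocharacter R l (Some p)) k != 0.
Proof.
by apply: posdeg_neq0; apply: posdeg_mix (posdeg_cochar l None) => p; apply: posdeg_cochar.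
Qed.

Lemma act_at_cochar i p :
  at_l (act c1 i A1 p) (act (cocharacter R l None) i (fun p => cocharacter R l (Some p)) p).
Proof.
apply: place_act; first exact: has_value_place.
- by move=> q; apply: has_value_ratid.
- by move=> q; apply: cochar_neq0.
- exact: has_value_ratid.
- exact: cochar_mix.
Qed.

Lemma posdeg_act_cochar i p :
  posdeg (act (cocharacter R l None) i (fun p => cocharacter R l (Some p)) p)
         (tact (l None) i (fun p => l (Some p)) p).
Proof. by apply: posdeg_act (posdeg_cochar l None) => q; apply: posdeg_cochar. Qed.

End Cocharacter.

(** It suffices to specialize to the trivial cocharacter, where the sum is still
    subtraction-free. *)
Lemma mix_neq0 i k : mix c1 i A1 k != 0.
Proof.
pose l : {ffun Ie -> int} := [ffun=> 0].
have hP := has_value_place (@ratfun1C R) (cocharacter R l).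
apply: (place_neq0 hP) (cochar_mix l i k); apply: place_mix => // *.
- exact: has_value_ratid.
- exact: cochar_neq0.
- exact: has_value_ratid.
Qed.

Lemma act_generic_neq0 i p : act c1 i A1 p != 0.
Proof. by apply: act_neq0 => *; [apply: mix_neq0 | apply: ratid_neq0]. Qed.

(** The projection in [e_] is a choice and does not commute with specialization by itself. So
    [e_generic] first rewrites e_i at the generic point as an explicit rational formula, which is
    then transported. *)
Lemma ratcomp_e i : ratcomp (gc_e (chi_Uminus R n) i) (ratpar (theta_hat R n)) =
  low_of_mx (theta_mx (act c1 i A1)).
Proof.
apply/funext => q; rewrite /ratcomp; apply: valueE; rewrite ratpar_theta.
set x := (X in has_value _ X _ _).
have hP := has_value_place (@ratfunC R Ie) x.
pose u : 'M[ratfun R Je]_n.+1 := mx_of_low (fun q : low n => ratid R (Some q)).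
have Hu : mx_place (has_value (@ratfunC R Ie) x) u (theta_mx A1).
  rewrite -(low_of_mxK (in_Uminus_theta A1)); apply: mx_place_low => // p.
  exact: (has_value_ratid (@ratfunC R Ie) x (Some p)).
have Hc : has_value (@ratfunC R Ie) x (ratid R None) c1.
  exact: (has_value_ratid (@ratfunC R Ie) x None).
have gt := generic_theta A1_neq0.
have gu : generic u by apply: (generic_place hP Hu) => //; apply: in_Uminus_mx_of_low.
have HA p : has_value (@ratfunC R Ie) x (theta_inv u p) (A1 p).
  by rewrite -(theta_mxK A1_neq0 p); apply: place_theta_inv.
have Hm k : mix (ratid R None) i (theta_inv u) k != 0.
  apply: (place_neq0 hP) (mix_neq0 i k); apply: place_mix => // p; exact: A1_neq0.
rewrite /= -/u e_generic //; last exact: ratid_neq0.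
apply: (place_theta hP) => [p|p]; last exact: act_generic_neq0.
apply: place_act => // [p'|k]; [exact: A1_neq0 | exact: mix_neq0].
Qed.

Lemma e_thetaE i : e_theta (chi_Uminus R n) (theta_hat R n) i = act c1 i A1.
Proof.
apply/funext => p; rewrite /e_theta (ratinvE theta_hat_invP) ratcomp_e.
have := low_of_mxK (in_Uminus_theta (act c1 i A1)).
have := theta_mxK (act_generic_neq0 i) p; have := generic_theta (act_generic_neq0 i).
move: (theta_mx _) => w gw <- wE.
apply: valueE; have hP := has_value_place (@ratfunC R Ie) (low_of_mx w).
apply: place_theta_inv => //; rewrite -{2}wE; apply: mx_place_low => // q.
exact: has_value_ratid.
Qed.

Lemma gamma_thetaE i : gamma_theta (chi_Uminus R n) (theta_hat R n) i =
  (\prod_(p : tabA n | (rowA p <= i)%N && (i <= colA p)%N) ratid R p)^-1.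
Proof.
apply: valueE => /=; rewrite /gamma_Uminus fund_weight_coroots => [|j]; last first.
  rewrite invr_neq0 // f_minor; apply: (proj2 generic_low_mx).
  have := ltn_ord j; lia.
rewrite -(f_theta i (@ratid_neq0 (tabA n))).
have hP := has_value_place (@ratfunC R (tabA n)) (theta_hat R n).
apply: placeV => //; first by rewrite !f_minor; apply: place_minor place_low_mx.
by rewrite f_theta; [apply/prodf_neq0 => *|]; apply: ratid_neq0.
Qed.

Lemma gamma_at_cochar i (l : {ffun tabA n -> int}) :
  exists2 g, has_value (@ratfun1C R) (cocharacter R l)
               (gamma_theta (chi_Uminus R n) (theta_hat R n) i) g
    & posdeg g (- \sum_(p : tabA n | (rowA p <= i)%N && (i <= colA p)%N) l p).
Proof.
pose Q := \prod_(p : tabA n | (rowA p <= i)%N && (i <= colA p)%N) cocharacter R l p.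
have hP := has_value_place (@ratfun1C R) (cocharacter R l).
have pQ : posdeg Q (\sum_(p : tabA n | (rowA p <= i)%N && (i <= colA p)%N) l p).
  by apply: posdeg_prod => p _; apply: posdeg_cochar.
exists Q^-1; last exact: posdegV.
rewrite gamma_thetaE; apply: placeV => //; last exact: posdeg_neq0 pQ.
by apply: place_prod => // p _; apply: has_value_ratid.
Qed.

Lemma theta_hat_positive : positive_structure (chi_Uminus R n) (theta_hat R n).
Proof.
split; first by exists theta_hat_inv; apply: theta_hat_invP.
  move=> i l; have [g gv pg] := gamma_at_cochar i l.
  by exists g => //; apply: posdeg_positive pg.
move=> i p l; rewrite e_thetaE.
exists (act (cocharacter R l None) i (fun p => cocharacter R l (Some p)) p).
  exact: act_at_cochar.
exact: posdeg_positive (posdeg_act_cochar l i p).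
Qed.

Lemma UD_gammaE l : UD_gamma (chi_Uminus R n) (theta_hat R n) l =
  [ffun i : 'I_n => - \sum_(p : tabA n | (rowA p <= i)%N && (i <= colA p)%N) l p].
Proof.
apply/ffunP => i; rewrite !ffunE; have [g gv pg] := gamma_at_cochar i l.
by rewrite (valueE gv) (posdeg_vdeg pg).
Qed.

Lemma UD_eE i b l : UD_e (chi_Uminus R n) (theta_hat R n) i b l =
  [ffun p => tact b i l p].
Proof.
apply/ffunP => p; rewrite /UD_e /ultradisc !ffunE e_thetaE.
set l' := finfun _; rewrite (valueE (act_at_cochar l' i p)).
rewrite (posdeg_vdeg (posdeg_act_cochar l' i p)) ffunE; congr tact.
by apply/funext => q; rewrite ffunE.
Qed.

End Coordinates.

(** * Maxima with an offset on an initial segment, and their first and last maximizers *)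

Lemma bigmax_spec (s : nat -> int) x0 j :
  let x := \big[Num.max/x0]_(m < j) s m in
  [/\ x0 <= x, forall m, (m < j)%N -> s m <= x
    & x = x0 \/ exists2 m, (m < j)%N & x = s m].
Proof.
elim: j s => [|j IH] s /=; first by rewrite big_ord0; split=> //; left.
rewrite big_ord_recl; have [] := IH (fun m => s m.+1).
set y := \big[_/_]_(_ < _) _ => H0 H1 H2; split=> [|[|m]|].
- by rewrite le_max H0 orbT.
- by rewrite le_max lexx.
- by rewrite ltnS le_max => /H1 ->; rewrite orbT.
case: (leP (s 0) y) => _; last by right; exists 0%N.
by case: H2 => [|[m mj E]]; [left|right; exists m.+1].
Qed.

Lemma bigmax_attained (t : nat -> int) j :
  let x := \big[Num.max/t 0]_(m < j) t m.+1 in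
  (forall m, (m <= j)%N -> t m <= x) /\ (exists2 m, (m <= j)%N & x = t m).
Proof.
have [H0 H1 H2] := bigmax_spec (fun m => t m.+1) (t 0) j; split=> [[|m]|] //.
  exact: H1.
by case: H2 => [->|[m mj ->]]; [exists 0%N | exists m.+1].
Qed.

Section MaxWithOffset.
Variables (i : nat) (a : nat -> int) (N : int -> nat -> int).
Hypothesis N_ge : forall d k m, (m <= i)%N -> (if (m < k)%N then d else 0) + a m <= N d k.
Hypothesis N_eq : forall d k, exists2 m, (m <= i)%N & N d k = (if (m < k)%N then d else 0) + a m.

Lemma N_lt d k m : (m < k)%N -> (m <= i)%N -> d + a m <= N d k.
Proof. by move=> mk mi; have := N_ge d k mi; rewrite mk. Qed.

Lemma N_nlt d k m : (k <= m)%N -> (m <= i)%N -> a m <= N d k.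
Proof. by move=> mk mi; have := N_ge d k mi; rewrite ltnNge mk add0r. Qed.

Lemma N_cases d k : (exists m, [/\ (m < k)%N, (m <= i)%N & N d k = d + a m]) \/
  (exists m, [/\ (k <= m)%N, (m <= i)%N & N d k = a m]).
Proof.
have [m mi] := N_eq d k; case: leqP => mk E; [right|left]; exists m; split=> //.
by rewrite E add0r.
Qed.

(** The tropical form of [an_act] at column i: for [N] given by [tmix], these are the numbers b_k of
    the tableau reached at exponent d. *)
Definition shifted d k := a k + (N d 0 - N d k) + (N d 0 - N d k.+1).

(** Let m be such that m+1 is the first k for which N_k is attained at some l < k. Beyond m this
    persists, so N_k rises with d; up to m every term carrying the offset is strictly smaller, so by
    integrality N_k stays. Since N_{m+1} = d + a_m, the value of [shifted] at m is 2 N_0 - d - N_m,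
    and the bounds on N_k and N_{k+1} compare the other values with it. *)
Lemma raise_offset d : 0 <= d -> exists2 m, (m <= i)%N &
  [/\ forall k, (k <= i)%N -> shifted d k <= shifted d m,
      forall k, (k < m)%N -> shifted d k < shifted d m
    & forall k, N (d + 1) k = N d k + (m < k)%N%:R].
Proof.
move=> d0.
pose g k := [exists l : 'I_i.+1, (l < k)%N && (d + a l == N d k)].
have gP k : reflect (exists l, [/\ (l < k)%N, (l <= i)%N & N d k = d + a l]) (g k).
  apply: (iffP existsP) => [[l /andP[lk /eqP E]]|[l [lk li E]]].
    by exists l; split=> //; rewrite -ltnS.
  by exists (Ordinal (li : (l < i.+1)%N)); rewrite lk /= E.
have gi : exists k, g k.
  exists i.+1; apply/gP; case: (N_cases d i.+1) => // -[l [il li _]].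
  by move: il; rewrite ltnNge li.
have [k0 gk0 mink0] := ex_minnP gi.
case: k0 gk0 mink0 => [/gP[l []//]|m gm minm].
have gS k : g k -> g k.+1.
  move=> /gP[l [lk li E]]; apply/gP.
  case: (N_cases d k.+1) => // -[l' [kl' li' E']].
  exists l; split=> //; first exact: ltnW.
  have := N_nlt d (ltnW kl') li'; have := N_lt d (ltnW lk : (l < k.+1)%N) li; lia.
have gE k : g k = (m < k)%N.
  case: (leqP k m) => km; first by apply/negbTE/negP => /minm; lia.
  by rewrite -(subnK km); elim: (k - m.+1)%N => // e IH; rewrite addSn; apply: gS.
have mi : (m <= i)%N.
  have /gP[l [lm li _]] := gm; rewrite leqNgt; apply/negP => im.
  suff : g i.+1 by rewrite gE; lia.
  apply/gP; case: (N_cases d i.+1) => // -[l' [il li' _]]; lia.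
have lowm l : (l < m)%N -> d + a l < N d m.
  move=> lm; have li : (l <= i)%N by lia.
  rewrite lt_neqAle N_lt // andbT; apply/negP => /eqP E.
  by have : g m; [apply/gP; exists l | rewrite gE ltnn].
have [l0 [ml0 l0i El0]] : exists l, [/\ (m <= l)%N, (l <= i)%N & N d m = a l].
  case: (N_cases d m) => // -[l [lm li E]]; have := lowm l lm; lia.
have Em : N d m.+1 = d + a m.
  have /gP[l [lm li E]] := gm; case: (ltngtP l m) => lm'; [|lia|by rewrite E lm'].
  have := lowm l lm'; have := N_lt d (ltnSn m) mi; case: (ltngtP m l0) => ml; [|lia|].
    have := N_nlt d ml l0i; lia.
  by rewrite -ml in El0; lia.
(* The sign of d enters when [l0 = m]: then N d m = a m <= d + a m = N d m.+1. *)
have mm1 : N d m <= N d m.+1.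
  case: (ltngtP m l0) => ml; [|lia|by rewrite -ml in El0; lia].
  have := N_nlt d ml l0i; lia.
have lts k : (k < m)%N -> shifted d k < shifted d m.
  move=> km; rewrite /shifted; have := lowm k km.
  have := N_nlt d (leq_trans (ltnW km) ml0) l0i; have := N_nlt d (leq_trans km ml0) l0i; lia.
exists m => //; split=> // k.
  move=> ki; case: (ltngtP k m) => km; [exact/ltW/lts| |by rewrite km].
  rewrite /shifted; have := N_lt d km mi; have := N_lt d (ltnSn k) ki; lia.
have H1 (l : nat) : (l <= i)%N -> (if (l < k)%N then d + 1 else 0) + a l <= N d k + (m < k)%N%:R.
  move=> li; case: ifP => lk.
    have := N_lt d lk li; case: (leqP k m) => km; last by lia.
    have : ~~ g k by rewrite gE; lia.
    move=> /gP ng; suff : N d k != d + a l by lia.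
    by apply/eqP => E; apply: ng; exists l.
  have kl : (k <= l)%N by rewrite leqNgt lk.
  have := N_nlt d kl li; lia.
apply: le_anti; apply/andP; split.
  by have [l li ->] := N_eq (d + 1) k; apply: H1.
case: (leqP k m) => km /=.
  case: (N_cases d k) => [[l [lk li E]]|[l [kl li E]]].
    have := N_lt (d + 1) lk li; lia.
  have := N_nlt (d + 1) kl li; lia.
have /gP[l [lk li E]] : g k by rewrite gE.
have := N_lt (d + 1) lk li; lia.
Qed.

(** The mirror argument: m is the last k for which N_k is attained at some l >= k. Up to m such a
    term keeps N_k unchanged, and beyond m all terms attaining N_k carry the offset and drop. *)
Lemma lower_offset d : d <= 0 -> exists2 m, (m <= i)%N &
  [/\ forall k, (k <= i)%N -> shifted d k <= shifted d m,
      forall k, (m < k)%N -> (k <= i)%N -> shifted d k < shifted d m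
    & forall k, N (d - 1) k = N d k - (m < k)%N%:R].
Proof.
move=> d0.
pose h k := [exists l : 'I_i.+1, (k <= l)%N && (a l == N d k)].
have hP k : reflect (exists l, [/\ (k <= l)%N, (l <= i)%N & N d k = a l]) (h k).
  apply: (iffP existsP) => [[l /andP[lk /eqP E]]|[l [lk li E]]].
    by exists l; split=> //; rewrite -ltnS.
  by exists (Ordinal (li : (l < i.+1)%N)); rewrite lk /= E.
have hi : exists k, ~~ h k.
  by exists i.+1; apply/hP => -[l [il li _]]; lia.
have [k0 hk0 mink0] := ex_minnP hi.
case: k0 hk0 mink0 => [/hP h0|m hm minm].
  by case: (N_cases d 0) => // -[l []].
have hS k : h k.+1 -> h k.
  move=> /hP[l [kl li E]]; apply/hP.
  case: (N_cases d k) => // -[l' [kl' li' E']].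
  exists l; split=> //; first exact: ltnW.
  have := N_lt d (ltnW kl' : (l' < k.+1)%N) li'; have := N_nlt d (ltnW kl) li; lia.
have hE k : h k = (k <= m)%N.
  case: (leqP k m) => km.
    by apply: contraT => /minm; lia.
  apply/negbTE; rewrite -(subnK km); elim: (k - m.+1)%N => // e IH.
  by rewrite addSn; apply: contra IH; apply: hS.
have mi : (m <= i)%N.
  have /hP[l [ml li _]] : h m by rewrite hE.
  lia.
have highm l : (m < l)%N -> (l <= i)%N -> a l < N d m.+1.
  move=> lm li; rewrite lt_neqAle N_nlt // andbT; apply/negP => /eqP E.
  by have : h m.+1; [apply/hP; exists l | rewrite hE ltnn].
have [l0 [l0m l0i El0]] : exists l, [/\ (l < m.+1)%N, (l <= i)%N & N d m.+1 = d + a l].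
  case: (N_cases d m.+1) => // -[l [lm li E]]; have := highm l lm li; lia.
have Em : N d m = a m.
  have /hP[l [lm li E]] : h m by rewrite hE.
  case: (ltngtP l m) => lm'; [lia| |by rewrite E lm'].
  have := highm l lm' li; have := N_nlt d (leqnn m) mi; case: (ltngtP l0 m) => ml; [|lia|].
    have := N_lt d ml l0i; lia.
  by rewrite ml in El0; lia.
have mm1 : N d m.+1 <= N d m.
  case: (ltngtP l0 m) => ml; [|lia|by rewrite ml in El0; lia].
  have := N_lt d ml l0i; lia.
have lts k : (m < k)%N -> (k <= i)%N -> shifted d k < shifted d m.
  move=> mk ki; rewrite /shifted; have := highm k mk ki.
  have := N_lt d (leq_trans l0m mk) l0i; have := N_lt d (leq_trans l0m (leqW mk)) l0i; lia.
exists m => //; split=> // k.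
  move=> ki; case: (ltngtP k m) => km; [|exact/ltW/lts|by rewrite km].
  rewrite /shifted; have := N_nlt d km mi; have := N_nlt d (leqnn k) ki; lia.
have H1 (l : nat) : (l <= i)%N -> (if (l < k)%N then d - 1 else 0) + a l <= N d k - (m < k)%N%:R.
  move=> li; case: ifP => lk.
    have := N_lt d lk li; lia.
  have kl : (k <= l)%N by rewrite leqNgt lk.
  have := N_nlt d kl li; case: (leqP k m) => km; first by lia.
  have : ~~ h k by rewrite hE; lia.
  move=> /hP nh; suff : N d k != a l by lia.
  by apply/eqP => E; apply: nh; exists l.
apply: le_anti; apply/andP; split.
  by have [l li ->] := N_eq (d - 1) k; apply: H1.
case: (leqP k m) => km /=.
  have /hP[l [lk li E]] : h k by rewrite hE.
  have := N_nlt (d - 1) lk li; lia.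
case: (N_cases d k) => [[l [lk li E]]|[l [kl li E]]].
  have := N_lt (d - 1) lk li; lia.
have := N_nlt (d - 1) kl li; lia.
Qed.

End MaxWithOffset.

(** * Comparison with the crystal of tableaux *)

Section Tableaux.
Variables (R : realType) (n : nat).
Implicit Types (v : Bsharp n) (i : 'I_n) (l : tabA n -> int).

(* Proved by taking degrees in [an_act]. *)
Lemma tan_tact d i l (k : nat) : (k <= i)%N ->
  tan (tact d i l) k i =
  tan l k i + (tmix d i l 0 - tmix d i l k) + (tmix d i l 0 - tmix d i l k.+1).
Proof.
move=> ki.
pose c : ratfun1 R := tofrac 'X ^ d; pose A p : ratfun1 R := tofrac 'X ^ l p.
have Al p : posdeg (A p) (l p) by apply: posdegX.
have cd : posdeg c d by apply: posdegX.
have M0 k' : mix c i A k' != 0 by apply: posdeg_neq0 (posdeg_mix Al i k' cd).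
have A0 p : A p != 0 by apply: posdeg_neq0 (Al p).
have := posdeg_vdeg (posdeg_an (fun p => posdeg_act Al i p cd) k i).
rewrite an_act ?eqxx // => <-; apply: posdeg_vdeg; rewrite -addrA.
apply: posdegM; first exact: posdeg_an.
by apply: posdegM; apply: posdeg_div; apply: posdeg_mix.
Qed.

Lemma tabB_of_tabA_bij : bijective (@tabB_of_tabA n).
Proof.
have lt1 (q : tabB n) : ((val q).1 < n)%N.
  by have := valP q; have := ltn_ord (val q).2; lia.
have lt2 (q : tabB n) : ((val q).2.-1 < n)%N.
  by have := valP q; have := ltn_ord (val q).2; lia.
have le12 (q : tabB n) : ((val q).1 <= (val q).2.-1)%N.
  by have := valP q; lia.
exists (fun q => exist _ (Ordinal (lt1 q), Ordinal (lt2 q)) (le12 q) : tabA n).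
  by move=> p; apply: val_inj; case: p => [[r c] rc]; congr (_, _); apply: val_inj.
move=> q; apply: val_inj; case: q => [[r c] /= rc].
by congr (_, _); apply: val_inj; rewrite //= /bump; lia.
Qed.

Lemma rowB_tabA (p : tabA n) : rowB (tabB_of_tabA p) = rowA p. Proof. by []. Qed.
Lemma colB_tabA (p : tabA n) : colB (tabB_of_tabA p) = (colA p).+1.
Proof. by rewrite /colB /= /bump. Qed.

Lemma cochar_of_tableau_bij : bijective (@cochar_of_tableau n).
Proof.
have [g gK Kg] := tabB_of_tabA_bij.
exists (fun l : {ffun tabA n -> int} => [ffun q => l (g q)] : Bsharp n) => [v|l];
  apply/ffunP => p; rewrite !ffunE.
  by rewrite Kg.
by rewrite gK.
Qed.

Lemma b_E v i k : (k <= i)%N -> b_ i v k = tan (cochar_of_tableau v) k i.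
Proof.
move=> ki; have bij := onW_bij _ tabB_of_tabA_bij.
rewrite /b_ /tan /tcol; congr (_ - _); rewrite (reindex _ (bij _)) /=.
  by apply: eq_big => p; rewrite ?ffunE // colB_tabA rowB_tabA eqSS ltnS.
case: (val i) ki => [|m] ki.
  by rewrite !big_pred0 // => p; rewrite ?colB_tabA //; move: ki; case: k => // _; rewrite andbF.
by apply: eq_big => p; rewrite ?ffunE // colB_tabA rowB_tabA eqSS.
Qed.

Lemma wt_cochar v : wt v =
  [ffun i : 'I_n => - \sum_(p : tabA n | (rowA p <= i)%N && (i <= colA p)%N) cochar_of_tableau v p].
Proof.
have bij := onW_bij _ tabB_of_tabA_bij.
apply/ffunP => i; rewrite !ffunE (reindex _ (bij _)) /=; congr (- _).
by apply: eq_big => p; rewrite ?ffunE // colB_tabA rowB_tabA ltnS.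
Qed.

Lemma tmix_attained d i l k :
  (forall m, (m <= i)%N -> (if (m < k)%N then d else 0) + tan l m i <= tmix d i l k) /\
  (exists2 m, (m <= i)%N & tmix d i l k = (if (m < k)%N then d else 0) + tan l m i).
Proof. exact: (bigmax_attained (tmix_term d i l k)). Qed.

Lemma epsilon_max v i (m : nat) : (m <= i)%N ->
  (forall k, (k <= i)%N -> b_ i v k <= b_ i v m) -> epsilon_ i v = b_ i v m.
Proof.
move=> mi H; have [_ H1 H2] := bigmax_spec (b_ i v) (b_ i v 0) i.+1.
rewrite /epsilon_; apply: le_anti; rewrite H1 // andbT.
by case: H2 => [->|[k ki ->]]; apply: H.
Qed.

Lemma m_first v i (m : nat) : (m <= i)%N ->
  (forall k, (k <= i)%N -> b_ i v k <= b_ i v m) ->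
  (forall k, (k < m)%N -> b_ i v k < b_ i v m) -> m_ i v = m :> nat.
Proof.
move=> mi H Hlt; have E := epsilon_max mi H; rewrite /m_ /arg_min /extremum E.
pose x : 'I_i.+1 := Ordinal (mi : (m < i.+1)%N).
case: pickP => [y /andP[/eqP Ey /forallP /(_ x)]|/(_ x)] /=.
  rewrite eqxx /= => ym; apply/eqP; rewrite eqn_leq ym leqNgt; apply/negP => /Hlt.
  by rewrite Ey ltxx.
rewrite eqxx /= => /forallP []; move=> y; apply/implyP => /eqP Ey.
by rewrite leqNgt; apply/negP => /Hlt; rewrite Ey ltxx.
Qed.

Lemma M_last v i (m : nat) : (m <= i)%N ->
  (forall k, (k <= i)%N -> b_ i v k <= b_ i v m) ->
  (forall k, (m < k)%N -> (k <= i)%N -> b_ i v k < b_ i v m) -> M_ i v = m :> nat.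
Proof.
move=> mi H Hlt; have E := epsilon_max mi H; rewrite /M_ /arg_max /extremum E.
pose x : 'I_i.+1 := Ordinal (mi : (m < i.+1)%N).
have le (y : 'I_i.+1) : b_ i v y = b_ i v m -> (y <= m)%N.
  by move=> Ey; rewrite leqNgt; apply/negP => /Hlt/(_ (ltn_ord y)); rewrite Ey ltxx.
case: pickP => [y /andP[/eqP Ey /forallP /(_ x)]|/(_ x)] /=.
  by rewrite eqxx /= => ym; apply/eqP; rewrite eqn_leq [(m <= y)%N]ym le.
rewrite eqxx /= => /forallP []; move=> y; apply/implyP => /eqP Ey; exact: le.
Qed.

(** Columns i and i+1 of B are columns i-1 and i of A. For m = i the first case is empty, because
    rows do not exceed columns, and this accounts for the ignored entry B_{i,i}. *)
Lemma cochar_shift i (m : nat) e v p : cochar_of_tableau (shift_tab i m e v) p =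
  if (rowA p == m) && ((colA p).+1 == i :> nat) then cochar_of_tableau v p + e
  else if (rowA p == m) && (colA p == i :> nat) then cochar_of_tableau v p - e
  else cochar_of_tableau v p.
Proof. by rewrite !ffunE colB_tabA rowB_tabA eqSS. Qed.

Section Step.
Variables (i : 'I_n) (l : tabA n -> int) (d : int) (v : Bsharp n).
Hypothesis vE : cochar_of_tableau v =1 tact d i l.

Lemma b_tact k : (k <= i)%N -> b_ i v k = shifted (fun m => tan l m i) (fun e => tmix e i l) d k.
Proof.
move=> ki; rewrite b_E // /shifted -tan_tact //; congr (tan _ _ _).
exact/funext.
Qed.

(** By [raise_offset] the difference N_k - N_{k+1} drops by one at k = m and nowhere else, and m is
    the row chosen by the raising operator. *)
Lemma etilde_tact : 0 <= d -> cochar_of_tableau (etilde i v) =1 tact (d + 1) i l.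
Proof.
move=> d0 p.
have [m mi [H1 H2 H3]] := raise_offset (fun e k => proj1 (tmix_attained e i l k))
  (fun e k => proj2 (tmix_attained e i l k)) d0.
rewrite /etilde (m_first mi) => [|k ki|k km]; last 2 first.
- by rewrite !b_tact //; apply: H1.
- by rewrite !b_tact //; [apply: H2 | lia].
rewrite cochar_shift vE /tact !H3.
case: (colA p =P i) => c1; case: ((colA p).+1 =P i) => c2; case: (rowA p =P m) => rm /=; lia.
Qed.

Lemma ftilde_tact : d <= 0 -> cochar_of_tableau (ftilde i v) =1 tact (d - 1) i l.
Proof.
move=> d0 p.
have [m mi [H1 H2 H3]] := lower_offset (fun e k => proj1 (tmix_attained e i l k))
  (fun e k => proj2 (tmix_attained e i l k)) d0.
rewrite /ftilde (M_last mi) => [|k ki|k km ki]; last 2 first.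
- by rewrite !b_tact //; apply: H1.
- by rewrite !b_tact //; apply: H2.
rewrite cochar_shift vE /tact !H3.
case: (colA p =P i) => c1; case: ((colA p).+1 =P i) => c2; case: (rowA p =P m) => rm /=; lia.
Qed.

End Step.

Lemma tact0 i l : tact 0 i l =1 l.
Proof.
have M k : tmix 0 i l k = tmix 0 i l 0.
  by rewrite /tmix /tmix_term; under eq_bigr => m _ do rewrite if_same; rewrite if_same.
by move=> p; rewrite /tact !M subrr addr0 !if_same.
Qed.

(** The base tableau stays fixed and only the exponent moves, away from 0, so each step meets the
    sign condition of [etilde_tact] or [ftilde_tact]. *)
Lemma etilde_powE i b v : cochar_of_tableau (etilde_pow i b v) =1 tact b i (cochar_of_tableau v).
Proof.
case: b => k; rewrite /etilde_pow.
  elim: k => [|k IH] p; first by rewrite tact0.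
  by rewrite iterS (etilde_tact IH) // -addn1 PoszD.
rewrite NegzE; elim: k.+1 => [|j IH] p; first by rewrite oppr0 tact0.
rewrite iterS (ftilde_tact IH) ?oppr_le0 //; congr (tact _ _ _ _); lia.
Qed.

End Tableaux.

Theorem theorem5p5 (R : realType) (n : nat) (hn : (1 <= n)%N) :
  [/\ positive_structure (chi_Uminus R n) (theta_hat R n),
      bijective (@cochar_of_tableau n),
      (forall (i : 'I_n) (b : int) (v : Bsharp n),
         UD_e (chi_Uminus R n) (theta_hat R n) i b (cochar_of_tableau v) =
         cochar_of_tableau (etilde_pow i b v))
    & (forall v : Bsharp n,
         UD_gamma (chi_Uminus R n) (theta_hat R n) (cochar_of_tableau v) = wt v)].
Proof.
split.
- exact: theta_hat_positive.
- exact: cochar_of_tableau_bij.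
- by move=> i b v; rewrite UD_eE; apply/ffunP => p; rewrite ffunE (etilde_powE R).
- by move=> v; rewrite UD_gammaE wt_cochar.
Qed.
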